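(* Let $p$ be as in the context. All junction conditions $\Phi=(\Phi_1,\Phi_2)\colon\left(\,]0,+\infty[\times A_0\right)^2\to\mathbb{R}^2$, in the variables $(a_l,u_l;a_r,u_r)$ with $u_l=(\rho_l,q_l)$ and $u_r=(\rho_r,q_r)$, such that $$\Phi_1(a_l,\rho_l,q_l;a_r,\rho_r,q_r)=a_r q_r-a_l q_l$$ and $\Phi_2(a_l,u_l;a_r,u_r)$ is given by one of the following four choices: - (L): $a_rP(u_r)-a_lP(u_l)$; - (p): $p(\rho_r)-p(\rho_l)$; - (P): $P(u_r)-P(u_l)$; - (S): $a_rP(u_r)-a_lP(u_l)-\int_{a_l}^{a_r}p\left(R(\alpha;\rho_l,q_l)\right)\,d\alpha$; satisfy the properties ($\Phi$0), ($\Phi$1), ($\Phi$2) and ($\Phi$3). Property ($\Phi$4) is satisfied by (p), (P) and (S), and not by (L).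
   Context: The pressure law satisfies $p\in C^2(\mathbb{R}^+;\mathbb{R}^+)$, $\mathbb{R}^+=[0,+\infty[$, with $p'(\rho)>0$ and $p''(\rho)\ge 0$ for all $\rho>0$. Write $u=(\rho,q)$, $P(u)=\frac{q^2}{\rho}+p(\rho)$, $\lambda_1(u)=\frac{q}{\rho}-\sqrt{p'(\rho)}$, $\lambda_2(u)=\frac q\rho+\sqrt{p'(\rho)}$. The subsonic region is $A_0=\{u\in\,]0,+\infty[\times\mathbb{R}\colon \lambda_1(u)<0<\lambda_2(u)\}$, and $\mathring{A}_0$ denotes its interior. The function $R(\cdot;\rho_l,q_l)$ in (S), which depends also on $a_l$, is the first component of the solution $a\mapsto(R(a),Q(a))$ of the Cauchy problem $$\frac{d}{da}Q(a)=-\frac{Q(a)}{a},\qquad \frac{d}{da}\left[aP(R(a),Q(a))\right]=p(R(a)),\qquad Q(a_l)=q_l,\quad R(a_l)=\rho_l ,$$ which can be rewritten as $$Q(a)=\frac{a_l}{a}q_l,\qquad \frac{d}{da}R(a)=\frac{R(a)}{a}\,\frac{a_l^2q_l^2}{a^2p'(R(a))R^2(a)-a_l^2q_l^2},\qquad R(a_l)=\rho_l .$$ Properties of a junction function $\Phi$: ($\Phi$0) Regularity: $\Phi\in C^1\left(\left(\,]0,+\infty[\times A_0\right)^2;\mathbb{R}^2\right)$. Moreover, the $2\times2$ matrix $D_{u_r}\Phi(a_l,u_l;a_r,u_r)$ is invertible for all $a_l,a_r>0$ and $u_l,u_r\in\mathring{A}_0$. ($\Phi$1) No-junction case: for all $a>0$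 and $u_l,u_r\in A_0$, $\Phi(a,u_l;a,u_r)=0$ if and only if $u_l=u_r$. ($\Phi$2) Left-right symmetry: for all $a_l,a_r>0$ and $(\rho_l,q_l),(\rho_r,q_r)\in A_0$, $\Phi(a_l,\rho_l,q_l;a_r,\rho_r,q_r)=0$ if and only if $\Phi(a_r,\rho_r,-q_r;a_l,\rho_l,-q_l)=0$. ($\Phi$3) Consistency: for all positive $a_l,a_m,a_r$ and all $u_l,u_m,u_r\in A_0$, if $\Phi(a_l,u_l;a_m,u_m)=0$ and $\Phi(a_m,u_m;a_r,u_r)=0$, then $\Phi(a_l,u_l;a_r,u_r)=0$. ($\Phi$4) Hydrostatic limit: for all positive $a_l,a_r$ and for all densities $\rho_l,\rho_r$, $\Phi(a_l,\rho_l,0;a_r,\rho_r,0)=0$ if and only if $p(\rho_l)=p(\rho_r)$.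
   Formalization: For (S), Φ is taken only at arguments where the solution R(·;ρ_l,q_l) exists from a_l to a_r (it becomes sonic and stops at small a_r when q_l≠0), not on all of (]0,+∞[×A_0)^2; (Φ0) is asserted on that open domain, and ''Φ=0'' means defined and zero. *)

(* Defs.v *)
From HB Require Import structures.
From mathcomp Require Import all_boot all_order all_algebra.
From mathcomp Require Import all_classical all_reals all_analysis.

Set Implicit Arguments.
Unset Strict Implicit.
Unset Printing Implicit Defensive.

Import Order.TTheory GRing.Theory Num.Theory.
Import numFieldNormedType.Exports.

Local Open Scope classical_set_scope.
Local Open Scope ring_scope.

(* At a boundary point of [D] (such as 0 in [0, +oo[) this is the one-sided
   derivative. *)
Definition has_derivative_on {R : realType} (D : set R) (f : R -> R)
    (x l : R) : Prop :=
  (f y - f x) / (y - x) @[y --> within (D `\ x) (nbhs x)] --> l.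

Definition C2_on {R : realType} (D : set R) (f : R -> R) : Prop :=
  exists f1 f2 : R -> R,
    [/\ forall x, D x -> has_derivative_on D f x (f1 x),
        forall x, D x -> has_derivative_on D f1 x (f2 x) &
        {within D, continuous f2}].

(* Only the values of [p] on [0, +oo[ matter. *)
Definition pressure_law {R : realType} (p : R -> R) : Prop :=
  [/\ C2_on `[0, +oo[ p,
      forall rho, 0 <= rho -> 0 <= p rho,
      forall rho, 0 < rho -> 0 < derive1 p rho &
      forall rho, 0 < rho -> 0 <= derive1n 2 p rho].

(* A state u = (rho, q) is a row vector of length 2. *)
Definition vec2 {R : realType} (x y : R) : 'rV[R]_2 :=
  \row_(j < 2) (if j == ord0 then x else y).
Definition density {R : realType} (u : 'rV[R]_2) : R := u ord0 ord0.
Definition momentum {R : realType} (u : 'rV[R]_2) : R := u ord0 ord_max.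

Definition momentum_flow {R : realType} (p : R -> R) (u : 'rV[R]_2) : R :=
  momentum u ^+ 2 / density u + p (density u).

Definition lambda1 {R : realType} (p : R -> R) (u : 'rV[R]_2) : R :=
  momentum u / density u - Num.sqrt (derive1 p (density u)).
Definition lambda2 {R : realType} (p : R -> R) (u : 'rV[R]_2) : R :=
  momentum u / density u + Num.sqrt (derive1 p (density u)).

Definition A0 {R : realType} (p : R -> R) : set 'rV[R]_2 :=
  [set u | [/\ 0 < density u, lambda1 p u < 0 & 0 < lambda2 p u]].

(* The arguments (a_l, u_l; a_r, u_r) of a junction function. *)
Definition junction_arg (R : realType) : normedModType R :=
  ((R * 'rV[R]_2) * (R * 'rV[R]_2))%type.

Definition subsonic_args {R : realType} (p : R -> R) : set (junction_arg R) :=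
  [set x | [/\ 0 < x.1.1, A0 p x.1.2, 0 < x.2.1 & A0 p x.2.2]].

(* A junction function comes with its domain of definition: formula (S) below
   makes sense only where the solution of its Cauchy problem exists.  An
   equation Phi(a_l, u_l; a_r, u_r) = 0 means that the left-hand side is defined
   and vanishes. *)
Record junction_function (R : realType) := JunctionFunction {
  domain : set (junction_arg R);
  value : junction_arg R -> 'rV[R]_2
}.

Definition vanishes {R : realType} (Phi : junction_function R)
    (al : R) (ul : 'rV[R]_2) (ar : R) (ur : 'rV[R]_2) : Prop :=
  domain Phi ((al, ul), (ar, ur)) /\ value Phi ((al, ul), (ar, ur)) = 0.

(* In finite dimension, continuity of the differential may be tested
   direction by direction. *)
Definition C1_on {R : realType} {V W : normedModType R} (D : set V)
    (f : V -> W) : Prop :=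
  [/\ open D, forall x, D x -> differentiable f x &
      forall (v : V) x, D x -> 'd f y v @[y --> x] --> 'd f x v].

(* [jacobian] acts on row vectors, hence is the transpose of the usual Jacobian
   matrix; this does not affect invertibility. *)
Definition Phi_regular {R : realType} (p : R -> R)
    (Phi : junction_function R) : Prop :=
  C1_on (domain Phi) (value Phi) /\
  forall (al ar : R) (ul ur : 'rV[R]_2), 0 < al -> 0 < ar ->
    interior (A0 p) ul -> interior (A0 p) ur ->
    domain Phi ((al, ul), (ar, ur)) ->
    jacobian (fun u : 'rV[R]_2 => value Phi ((al, ul), (ar, u))) ur \in unitmx.

Definition Phi_no_junction {R : realType} (p : R -> R)
    (Phi : junction_function R) : Prop :=
  forall (a : R) (ul ur : 'rV[R]_2), 0 < a -> A0 p ul -> A0 p ur ->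
    (vanishes Phi a ul a ur <-> ul = ur).

Definition Phi_symmetric {R : realType} (p : R -> R)
    (Phi : junction_function R) : Prop :=
  forall al ar rhol ql rhor qr : R, 0 < al -> 0 < ar ->
    A0 p (vec2 rhol ql) -> A0 p (vec2 rhor qr) ->
    (vanishes Phi al (vec2 rhol ql) ar (vec2 rhor qr) <->
     vanishes Phi ar (vec2 rhor (- qr)) al (vec2 rhol (- ql))).

Definition Phi_consistent {R : realType} (p : R -> R)
    (Phi : junction_function R) : Prop :=
  forall (al am ar : R) (ul um ur : 'rV[R]_2),
    0 < al -> 0 < am -> 0 < ar -> A0 p ul -> A0 p um -> A0 p ur ->
    vanishes Phi al ul am um -> vanishes Phi am um ar ur ->
    vanishes Phi al ul ar ur.

Definition Phi_hydrostatic {R : realType} (p : R -> R)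
    (Phi : junction_function R) : Prop :=
  forall al ar rhol rhor : R, 0 < al -> 0 < ar -> 0 < rhol -> 0 < rhor ->
    (vanishes Phi al (vec2 rhol 0) ar (vec2 rhor 0) <-> p rhol = p rhor).

Definition mass_defect {R : realType} (x : junction_arg R) : R :=
  x.2.1 * momentum x.2.2 - x.1.1 * momentum x.1.2.

Definition Phi_L {R : realType} (p : R -> R) : junction_function R :=
  JunctionFunction (subsonic_args p) (fun x =>
    vec2 (mass_defect x) (x.2.1 * momentum_flow p x.2.2 - x.1.1 * momentum_flow p x.1.2)).

Definition Phi_p {R : realType} (p : R -> R) : junction_function R :=
  JunctionFunction (subsonic_args p) (fun x =>
    vec2 (mass_defect x) (p (density x.2.2) - p (density x.1.2))).

Definition Phi_P {R : realType} (p : R -> R) : junction_function R :=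
  JunctionFunction (subsonic_args p) (fun x =>
    vec2 (mass_defect x) (momentum_flow p x.2.2 - momentum_flow p x.1.2)).

(* [r], [q] solve the Cauchy problem for the stationary equations with datum
   [ul] at [al], on some open interval of positive sections containing both
   [al] and [a]. *)
Definition stationary_solution {R : realType} (p : R -> R)
    (al : R) (ul : 'rV[R]_2) (a : R) (r q : R -> R) : Prop :=
  [/\ r al = density ul, q al = momentum ul &
      exists lo hi : R,
        [/\ 0 <= lo, lo < al < hi, lo < a < hi &
            forall b : R, lo < b < hi ->
              [/\ 0 < r b, derivable r b 1,
                  is_derive b 1 q (- (q b / b)) &
                  is_derive b 1 (fun c => c * momentum_flow p (vec2 (r c) (q c)))
                    (p (r b))]]].

(* R(a; rho_l, q_l), for a in the interval of existence of the maximal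
   solution; the value elsewhere is irrelevant. *)
Definition stationary_density {R : realType} (p : R -> R)
    (al : R) (ul : 'rV[R]_2) (a : R) : R :=
  get [set y | exists r q : R -> R,
                 stationary_solution p al ul a r q /\ r a = y].

Definition oriented_integral {R : realType} (f : R -> R) (a b : R) : R :=
  if a <= b then \int[lebesgue_measure]_(x in `[a, b]) f x
  else - \int[lebesgue_measure]_(x in `[b, a]) f x.

(* If q_l != 0, the solution of the Cauchy problem becomes sonic, hence stops,
   at some positive section smaller than a_l: (S) is not defined on the whole
   of [subsonic_args p]. *)
Definition Phi_S {R : realType} (p : R -> R) : junction_function R :=
  JunctionFunction
    (subsonic_args p `&`
     [set x | exists r q : R -> R,
                stationary_solution p x.1.1 x.1.2 x.2.1 r q])
    (fun x =>
      vec2 (mass_defect x)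
        (x.2.1 * momentum_flow p x.2.2 - x.1.1 * momentum_flow p x.1.2 -
         oriented_integral
           (fun b => p (stationary_density p x.1.1 x.1.2 b)) x.1.1 x.2.1)).

(* Main.v *)
(* Along a C^1 stationary solution not only the discharge [a q] but also the
   Bernoulli quantity [q^2 / (2 rho^2) + h(rho)], with [h' = p' / rho], is
   conserved: the balance law for [a P] reads
   [a (p' - q^2 / rho^2) rho' = q^2 / rho].  It also forbids sonic points unless
   [q = 0], so a solution issued from a subsonic state stays subsonic.  For a
   fixed momentum both [P] and the Bernoulli quantity increase with the density
   on the subsonic range [q^2 < rho^2 p'(rho)], which is an up-set because
   [p'' >= 0].  Hence [R(a; rho_l, q_l)] is the unique subsonic root of the
   equation saying that the Bernoulli quantity, with [a_l q_l / a] for momentum,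
   has the value it takes at [u_l].
   This root exists on an open set of data and is C^1 there by implicit
   differentiation; by the fundamental theorem of calculus the second component
   of (S) is [a_r (P(u_r) - P(R(a_r), Q(a_r)))].  So each of the four conditions
   says that [a q] and one further quantity agree on both sides, from which all
   the properties follow. *)

Require Import Defs.
From HB Require Import structures.
From mathcomp Require Import all_boot all_order all_algebra.
From mathcomp Require Import all_classical all_reals all_analysis.
From mathcomp Require Import ring lra.

Set Implicit Arguments.
Unset Strict Implicit.
Unset Printing Implicit Defensive.

Import Order.TTheory GRing.Theory Num.Theory.
Import numFieldNormedType.Exports.

Local Open Scope classical_set_scope.
Local Open Scope ring_scope.

(** * Continuously differentiable functions *)

Section C1.
Context {R : realType}.
Implicit Types V W : normedModType R.

Lemma differentiable_eps V W (f : V -> W) x :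
  differentiable f x -> forall e : R, 0 < e ->
  \forall h \near (0 : V), `|f (h + x) - f x - 'd f x h| <= e * `|h|.
Proof.
move=> /diff_locally df e e0.
pose o := [o_ 0 id of f \o shift x - (cst (f x) + ('d f x : V -> W))].
have H h : f (h + x) - f x - 'd f x h = o h.
  have := congr1 (fun g => g h) df; rewrite !fctE /= => ->.
  by rewrite -[LHS]addrA -opprD addrC addKr.
have := littleoP [littleo of o] e0.
by apply: filterS => h; rewrite H.
Qed.

Lemma is_diff_eps V W (f : V -> W) (df : {linear V -> W}) x :
  continuous df ->
  (forall e : R, 0 < e ->
    \forall h \near (0 : V), `|f (h + x) - f x - df h| <= e * `|h|) ->
  is_diff x f df.
Proof.
move=> cdf H.
have E : f \o shift x = cst (f x) + df +o_ 0 id.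
  apply/eqaddoP => e e0.
  have := H _ e0; apply: filterS => h /=.
  by rewrite !fctE /= opprD addrA.
have dE := diff_unique cdf E.
by apply: DiffDef => //; apply/diff_locallyP; rewrite dE.
Qed.

Lemma near_eq_is_diff V W (f g df : V -> W) x :
  (\forall y \near x, f y = g y) -> is_diff x f df -> is_diff x g df.
Proof.
move=> fg [df1 df2]; rewrite -df2.
apply: is_diff_eps; first exact: diff_continuous.
move=> e e0.
have fgx := nbhs_singleton fg.
have fgh : \forall h \near (0 : V), f (h + x) = g (h + x).
  by move: fg; rewrite (near_shift 0 x) /=; apply: filterS => h; rewrite subr0.
have := differentiable_eps df1 e0; apply: filterS2 fgh => h -> .
by rewrite fgx.
Qed.

(** Only continuity of [A] at [x] is asked: this is how the implicitly defined root, at first known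
    to be merely continuous, gets differentiated. *)
Lemma is_diff_caratheodory V (A g f : V -> R) x :
  {for x, continuous A} -> differentiable g x ->
  (\forall y \near x, f y - f x = A y * (g y - g x)) ->
  is_diff x f (A x *: ('d g x : V -> R)).
Proof.
move=> cA dg fAg.
have cdg : continuous (A x \*: 'd g x).
  by move=> v; apply: continuousZl_tmp; apply: diff_continuous.
apply: (@is_diff_eps _ _ f (A x \*: 'd g x)) => // e e0.
have [k k0 dgk] := linear_lipschitz (diff_continuous dg).
(* The error is [A (h + x)] times the remainder of [g] plus [A (h + x) - A x] times ['d g x h]. As
   [M] bounds [A] near [x] and [k] bounds ['d g x], the tolerances [e / (2 * M)] and [d] make each
   term at most [e / 2] times the norm of [h]. *)
pose d := e / (2 * (k + 1)).
have k1 : 0 < k + 1 by apply: ltr_wpDl; [exact: ltW|].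
have d0 : 0 < d by rewrite divr_gt0// mulr_gt0.
pose M := `|A x| + d.
have M0 : 0 < M by rewrite ltr_wpDl.
have cAh : \forall h \near (0 : V), `|A x - A (h + x)| < d.
  have : \forall y \near x, `|A x - A y| < d by have /cvgrPdist_lt/(_ _ d0) := cA.
  by rewrite (near_shift 0 x) /=; apply: filterS => h; rewrite subr0.
have fAgh : \forall h \near (0 : V), f (h + x) - f x = A (h + x) * (g (h + x) - g x).
  by move: fAg; rewrite (near_shift 0 x) /=; apply: filterS => h; rewrite subr0.
have eM0 : 0 < e / (2 * M) by rewrite divr_gt0// mulr_gt0.
have dgh := differentiable_eps dg eM0.
near=> h.
have -> : f (h + x) - f x - (A x \*: 'd g x) h =
   A (h + x) * (g (h + x) - g x - 'd g x h) + (A (h + x) - A x) * 'd g x h.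
  rewrite (near fAgh h)//= /GRing.scale /=; ring.
apply: (le_trans (ler_normD _ _)).
rewrite !normrM.
have H1 : `|A (h + x)| <= M.
  rewrite /M -lerBlDl (le_trans (lerB_dist _ _))// distrC ltW//.
  exact: (near cAh h).
have H2 : `|A (h + x) - A x| <= d.
  by rewrite distrC ltW//; exact: (near cAh h).
have H3 := dgk h.
have H4 : `|g (h + x) - g x - 'd g x h| <= e / (2 * M) * `|h| by exact: (near dgh h).
have H5 : `|A (h + x)| * `|g (h + x) - g x - 'd g x h| <= e / 2 * `|h|.
  apply: le_trans (ler_pM _ _ H1 H4) _ => //.
  by rewrite mulrA le_eqVlt; apply/orP; left; apply/eqP; field; rewrite gt_eqF.
have H6 : `|A (h + x) - A x| * `|'d g x h| <= e / 2 * `|h|.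
  apply: le_trans (ler_pM _ _ H2 H3) _ => //.
  rewrite mulrA ler_wpM2r// /d.
  have -> : e / (2 * (k + 1)) * k = e / 2 * (k / (k + 1)) by field; rewrite gt_eqF.
  rewrite ler_piMr//; first by rewrite divr_ge0// ltW.
  by rewrite ler_pdivrMr// mul1r lerDl.
by rewrite (splitr e) mulrDl lerD.
Unshelve. all: by end_near. Qed.

Lemma is_diff_linear V W (f : V -> W) x : linear f -> continuous f -> is_diff x f f.
Proof.
move=> lf cf.
pose fM := GRing.isLinear.Build _ _ _ _ _ lf.
pose fL : {linear _ -> _} := HB.pack f fM.
have := @linear_differentiable _ _ _ fL x cf.
have := @diff_lin _ _ _ fL x cf.
by move=> H1 H2; apply: DiffDef.
Qed.

Lemma is_diff_comp_real V (f df : V -> R) (g : R -> R) (dg : R) x :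
  is_derive (f x) 1 g dg -> is_diff x f df -> is_diff x (fun y => g (f y)) (dg *: df).
Proof.
move=> [h2 h2e] [h1 h1e].
have dgx : differentiable g (f x) by apply/derivable1_diffP.
apply: DiffDef; first exact: differentiable_comp.
rewrite (_ : (fun y => g (f y)) = g \o f)// diff_comp//.
apply/funext => v /=; rewrite diff1E//= derive1E h2e -h1e.
exact: mulrC.
Qed.

(* The differential is carried as an explicit witness [df], so that its
   continuity can be transported through the operations on functions. *)
Definition C1_at V W (f : V -> W) x :=
  exists2 df : V -> V -> W, \forall y \near x, is_diff y f (df y) &
    forall v, {for x, continuous (df^~ v)}.

Lemma C1_at_C1_on V W (f : V -> W) D :
  open D -> (forall x, D x -> C1_at f x) -> C1_on D f.
Proof.
move=> oD H; split=> //.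
  by move=> x /H[df /nbhs_singleton[]].
move=> v x /H[df ddf cdf].
rewrite (_ : 'd f x v = df x v); last by have /nbhs_singleton[_ ->] := ddf.
apply: cvg_trans (cdf v); apply: near_eq_cvg.
by apply: filterS ddf => y [_ ->].
Qed.

Lemma C1_at_near V W (f g : V -> W) x :
  (\forall y \near x, f y = g y) -> C1_at f x -> C1_at g x.
Proof.
move=> fg [df ddf cdf]; exists df => //.
(* [near_eq_is_diff] is applied at every [y] near [x], so the equality is needed near each such
   [y]. *)
move/near_join: fg => fg.
by apply: filterS2 ddf fg => y d1 fg1; apply: near_eq_is_diff fg1 d1.
Qed.

Lemma C1_at_continuous V W (f : V -> W) x : C1_at f x -> {for x, continuous f}.
Proof. by move=> [df /nbhs_singleton[? _] _]; apply: differentiable_continuous. Qed.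

Lemma C1_at_cst V W (a : W) (x : V) : C1_at (fun=> a) x.
Proof.
exists (fun=> 0); last by move=> v; apply: cst_continuous.
by apply: nearW => y; apply: is_diff_cst.
Qed.

Lemma C1_at_linear V W (f : V -> W) x : linear f -> continuous f -> C1_at f x.
Proof.
move=> lf cf; exists (fun=> f); last by move=> v; apply: cst_continuous.
by apply: nearW => y; apply: is_diff_linear.
Qed.

Lemma C1_atD V W (f g : V -> W) x :
  C1_at f x -> C1_at g x -> C1_at (fun y => f y + g y) x.
Proof.
move=> [df d1 c1] [dg d2 c2]; exists (fun y => df y + dg y).
  by apply: filterS2 d1 d2 => y h1 h2; apply: (is_diffD h1 h2).
by move=> v; apply: (continuousD (c1 v) (c2 v)).
Qed.

Lemma C1_atM V (f g : V -> R) x :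
  C1_at f x -> C1_at g x -> C1_at (fun y => f y * g y) x.
Proof.
move=> Cf Cg; have cf := C1_at_continuous Cf; have cg := C1_at_continuous Cg.
case: Cf Cg => [df d1 c1] [dg d2 c2]; exists (fun y => f y *: dg y + g y *: df y).
  by apply: filterS2 d1 d2 => y h1 h2; apply: (is_diffM h1 h2).
move=> v; apply: (@continuousD _ _ _ (fun y => f y * dg y v) (fun y => g y * df y v)).
  exact: continuousM.
exact: continuousM.
Qed.

Lemma C1_atN V (f : V -> R) x : C1_at f x -> C1_at (fun y => - f y) x.
Proof.
move=> Cf; have := C1_atM (C1_at_cst (-1 : R) x) Cf.
by apply: C1_at_near; apply: nearW => y; rewrite mulN1r.
Qed.

Lemma C1_atB V (f g : V -> R) x :
  C1_at f x -> C1_at g x -> C1_at (fun y => f y - g y) x.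
Proof. by move=> Cf Cg; apply: C1_atD => //; apply: C1_atN. Qed.

Lemma C1_at_comp V (f : V -> R) (g dg : R -> R) x :
  (\forall z \near f x, is_derive (z : R) (1 : R) g (dg z)) -> {for f x, continuous dg} ->
  C1_at f x -> C1_at (fun y => g (f y)) x.
Proof.
move=> gd cdg Cf; have cf := C1_at_continuous Cf.
case: Cf => df d1 c1; exists (fun y => dg (f y) *: df y).
  have gd' := cf _ gd.
  apply: filterS2 d1 gd' => y h1 /= h2.
  exact: is_diff_comp_real.
move=> v; apply: (@continuousM _ _ (dg \o f) (df^~ v)) => //.
exact: continuous_comp.
Qed.

Lemma is_derive_inv (x : R) : x != 0 -> is_derive x 1 (fun y : R => y^-1) (- x ^- 2).
Proof.
move=> x0; have := @is_deriveV _ id x 1 1.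
rewrite /= /GRing.scale /= mulr1; apply=> //; exact: is_derive_id.
Qed.

Lemma C1_atV V (f : V -> R) x : f x != 0 -> C1_at f x -> C1_at (fun y => (f y)^-1) x.
Proof.
move=> fx0; apply: (@C1_at_comp _ _ GRing.inv (fun z => - z ^- 2)).
  have : \forall z \near f x, z != 0.
    have : id z @[z --> f x] --> f x by exact: cvg_id.
    by move/cvgr_neq0; apply.
  by apply: filterS => z z0; apply: is_derive_inv.
apply: continuousN; apply: continuousV; first by rewrite sqrf_eq0.
exact: exprn_continuous.
Qed.

End C1.

(** * Mean values and antiderivatives on the positive half-line *)

Section RealFunctions.
Context {R : realType}.
Implicit Types f g : R -> R.

Lemma is_derive_continuous f (df x : R) : is_derive x 1 f df -> {for x, continuous f}.
Proof. by move=> [/derivable1_diffP ? _]; apply: differentiable_continuous. Qed.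

Lemma near_lt (T : topologicalType) (f g : T -> R) (x : T) :
  {for x, continuous f} -> {for x, continuous g} -> f x < g x ->
  \forall y \near x, f y < g y.
Proof.
move=> cf cg fg.
have cgf : {for x, continuous (g - f)} by exact: continuousB.
have /= := cvgr_gt _ cgf 0.
rewrite [X in (_ < X) -> _](_ : _ = g x - f x)// subr_gt0 => /(_ _ fg).
by apply: filterS => y; rewrite -[(g - f) y]/(g y - f y) subr_gt0.
Qed.

Lemma mean_value f (df : R -> R) (a b : R) : a < b ->
  (forall x : R, a <= x <= b -> is_derive x 1 f (df x)) ->
  exists2 c, a < c < b & f b - f a = df c * (b - a).
Proof.
move=> ab dfx.
have [x||c] := @MVT _ f df a b ab.
- by rewrite in_itv => /andP[/ltW ax /ltW xb]; apply: dfx; rewrite ax.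
- apply: derivable_within_continuous => x; rewrite in_itv => /dfx; by case.
- by rewrite in_itv => ? ?; exists c.
Qed.

Lemma derive0_eq f (lo hi : R) : (forall x : R, lo < x < hi -> is_derive x 1 f 0) ->
  forall a b, lo < a < hi -> lo < b < hi -> f a = f b.
Proof.
move=> df a b; wlog ab : a b / a < b.
  by move=> H ha hb; have [/H->|/H->|->] := ltgtP a b.
move=> /andP[la _] /andP[_ bh]; apply/eqP; rewrite eq_sym -subr_eq0.
have [x /andP[ax xb]|c _ ->] := @mean_value f (fun=> 0) a b ab; last by rewrite mul0r.
by apply: df; rewrite (lt_le_trans la ax) (le_lt_trans xb bh).
Qed.

Lemma continuous_antiderivative g : (forall x : R, 0 < x -> {for x, continuous g}) ->
  exists h : R -> R, forall x : R, 0 < x -> is_derive x 1 h (g x).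
Proof.
move=> cg.
pose F (e x : R) := \int[lebesgue_measure]_(t in `[e, x]) g t.
have dF (e x : R) : 0 < e -> e < x -> is_derive x 1 (F e) (g x).
  move=> e0 ex.
  have [|||d1 d2] := @continuous_FTC1_closed R g e x (x + 1) _ _ ex.
  - by rewrite ltrDl.
  - apply: (@continuous_compact_integrable R g); first exact: segment_compact.
    apply: continuous_in_subspaceT => y; rewrite inE /= in_itv /= => /andP[ey _].
    by apply: cg; exact: lt_le_trans ey.
  - by apply: cg; exact: lt_trans ex.
  by apply: DeriveDef => //; rewrite -derive1E.
(* [F e] has no meaning at [0], so the lower bound [e] must depend on [x]; the
   increment [F e x - F e 1] does not depend on it. *)
have FF (e e' x : R) : 0 < e -> 0 < e' -> e < x -> e' < x -> e < 1 -> e' < 1 ->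
    F e x - F e 1 = F e' x - F e' 1.
  move=> e0 e'0 ex e'x e1 e'1.
  suff : F e x - F e' x = F e 1 - F e' 1 by move=> H; lra.
  apply: (@derive0_eq (fun x => F e x - F e' x) (Num.max e e') (Num.max x 1 + 1)).
  - move=> y; rewrite gt_max => /andP[/andP[ey e'y] _].
    have := is_deriveB (dF _ _ e0 ey) (dF _ _ e'0 e'y).
    by rewrite subrr.
  - by rewrite gt_max ex e'x /= ltr_pwDr// le_max lexx.
  - by rewrite gt_max e1 e'1 /= ltr_pwDr// le_max lexx orbT.
exists (fun x => F (Num.min x 1 / 2) x - F (Num.min x 1 / 2) 1) => x x0.
(* For [y > x / 2] the fixed base point [e0] may replace the moving one by [FF], so near [x] the
   function is [F e0] minus a constant. *)
pose e0 := Num.min x 1 / 4.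
have m0 : 0 < Num.min x 1 by rewrite lt_min x0 ltr01.
have m1 : Num.min x 1 <= 1 by rewrite ge_min lexx orbT.
have mx : Num.min x 1 <= x by rewrite ge_min lexx.
have e00 : 0 < e0 by rewrite /e0; lra.
have := @dF e0 x e00; move=> /(_ ltac:(rewrite /e0; lra)) dFx.
have := is_deriveB dFx (is_derive_cst (F e0 1) x 1); rewrite subr0.
apply: near_eq_is_derive.
have near_x : \forall y \near x, x / 2 < y by apply: lt_nbhsr; lra.
apply: filterS near_x => y xy /=.
have y0 : 0 < y by lra.
have my0 : 0 < Num.min y 1 by rewrite lt_min y0 ltr01.
have my1 : Num.min y 1 <= 1 by rewrite ge_min lexx orbT.
have myx : Num.min y 1 <= y by rewrite ge_min lexx.
by apply: (@FF e0); rewrite /e0; lra.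
Qed.

End RealFunctions.

(** * The pressure law and its enthalpy *)

Section Pressure.
Context {R : realType} (p : R -> R).
Hypothesis hp : pressure_law p.
Local Notation dp := (derive1 p).

(** Near [r > 0] the constraint of lying in the half-line is void, so the restricted limit is a full
    punctured limit. *)
Lemma has_derivative_on_is_derive (f : R -> R) (l r : R) : 0 < r ->
  has_derivative_on `[0, +oo[ f r l -> is_derive r 1 f l.
Proof.
move=> r0 H; apply/is_derive1_caratheodory.
exists (fun z => if z == r then l else (f z - f r) / (z - r)); split.
- move=> z; case: eqP => [->|/eqP]; first by rewrite !subrr mulr0.
  by rewrite -subr_eq0 => /divfK->.
- apply/continuous_withinNx; rewrite eqxx.
  have {}H : (f y - f r) / (y - r) @[y --> r^'] --> l.
    move=> A /H; rewrite /nbhs /= /within /= => HA.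
    have Ir : \forall y \near r, 0 < y by apply: lt_nbhsr.
    move: HA Ir; apply: filterS2 => y Hy y0 yr; apply: Hy; split.
      by rewrite /= in_itv /= ltW.
    by apply/eqP.
  apply: cvg_trans H; apply: near_eq_cvg; near=> y.
  by rewrite ifN//; near: y; exact: nbhs_dnbhs_neq.
- by rewrite eqxx.
Unshelve. all: by end_near. Qed.

(** [f1] coincides with [derive1 p] on all positive densities, hence near each of them, so [f2] also
    differentiates [derive1 p] and inherits the sign of [derive1n 2 p]. *)
Lemma pressure_C2 : exists f2 : R -> R, forall r : R, 0 < r ->
  [/\ is_derive r 1 p (dp r), is_derive r 1 dp (f2 r) & 0 <= f2 r].
Proof.
case: hp => -[f1 [f2 [h1 h2 _]]] _ _ H2.
have d1 (r : R) : 0 < r -> is_derive r 1 p (f1 r).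
  by move=> r0; apply: has_derivative_on_is_derive => //; apply: h1;
    rewrite /= in_itv /= ltW.
have d2 (r : R) : 0 < r -> is_derive r 1 f1 (f2 r).
  by move=> r0; apply: has_derivative_on_is_derive => //; apply: h2;
    rewrite /= in_itv /= ltW.
have E1 (r : R) : 0 < r -> dp r = f1 r by move=> /d1[_ <-]; rewrite derive1E.
have d2' (r : R) : 0 < r -> is_derive r 1 dp (f2 r).
  move=> r0; apply: near_eq_is_derive (d2 _ r0).
  have : \forall y \near r, 0 < y by apply: lt_nbhsr.
  by apply: filterS => y y0; rewrite E1.
exists f2 => r r0; split; [by rewrite E1//; exact: d1|exact: d2'|].
have := H2 _ r0; rewrite derive1nS derive1n1 derive1E.
by have [_ ->] := d2' _ r0.
Qed.

Lemma pressure_is_derive (r : R) : 0 < r -> is_derive r 1 p (dp r).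
Proof. by have [f2 H] := pressure_C2 => /H[]. Qed.

Lemma dpressure_continuous (r : R) : 0 < r -> {for r, continuous dp}.
Proof. by have [f2 H] := pressure_C2 => /H[_ + _]; apply: is_derive_continuous. Qed.

Lemma pressure_continuous (r : R) : 0 < r -> {for r, continuous p}.
Proof. by move=> /pressure_is_derive; apply: is_derive_continuous. Qed.

Lemma dpressure_gt0 (r : R) : 0 < r -> 0 < dp r.
Proof. by case: hp => _ _ + _; apply. Qed.

Lemma dpressure_le (r s : R) : 0 < r -> r <= s -> dp r <= dp s.
Proof.
move=> r0; rewrite le_eqVlt => /predU1P[->//|rs].
have [f2 H] := pressure_C2.
have [x /andP[rx _]|c /andP[rc _] E] := @mean_value _ dp f2 r s rs.
  by have [] := H _ (lt_le_trans r0 rx).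
have [_ _ fc] := H _ (lt_trans r0 rc).
by rewrite -subr_ge0 E mulr_ge0// subr_ge0 ltW.
Qed.

Lemma pressure_lt (r s : R) : 0 < r -> r < s -> p r < p s.
Proof.
move=> r0 rs.
have [x /andP[rx _]|c /andP[rc _] E] := @mean_value _ p dp r s rs.
  by apply: pressure_is_derive; exact: lt_le_trans rx.
by rewrite -subr_gt0 E mulr_gt0 ?subr_gt0// dpressure_gt0// (lt_trans r0).
Qed.

Lemma pressure_inj (r s : R) : 0 < r -> 0 < s -> p r = p s -> r = s.
Proof.
move=> r0 s0 E; have [rs|sr|//] := ltgtP r s.
  by have := pressure_lt r0 rs; rewrite E ltxx.
by have := pressure_lt s0 sr; rewrite E ltxx.
Qed.

Lemma enthalpy_exists :
  exists h : R -> R, forall r : R, 0 < r -> is_derive r 1 h (dp r / r).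
Proof.
apply: (@continuous_antiderivative _ (fun r => dp r / r)) => x x0.
apply: continuousM; first exact: dpressure_continuous.
apply: continuousV; [by rewrite gt_eqF|exact: cvg_id].
Qed.

(** The additive constant left free by this choice cancels whenever two Bernoulli quantities are
    compared. *)
Definition enthalpy : R -> R := projT1 (cid enthalpy_exists).

Lemma enthalpy_is_derive (r : R) : 0 < r -> is_derive r 1 enthalpy (dp r / r).
Proof. exact: (projT2 (cid enthalpy_exists)). Qed.

(** Beyond density 1, [derive1 p] stays above [c = derive1 p 1], so the enthalpy grows at least like
    [c * ln r]. This supplies the upper end point when roots are found by intermediate values. *)
Lemma enthalpy_unbounded (m M : R) : exists2 r, m < r & M < enthalpy r.
Proof.
pose c := dp 1.
have c0 : 0 < c by apply: dpressure_gt0.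
have H (r : R) : 1 < r -> enthalpy 1 + c * ln r <= enthalpy r.
  move=> r1.
  have [x /andP[x1 _]|d /andP[d1 dr]] :=
      @mean_value _ (fun x => enthalpy x - c * ln x) (fun x => dp x / x - c * x^-1) 1 r r1.
    have x0 : 0 < x by lra.
    exact: (is_deriveB (enthalpy_is_derive x0) (is_deriveZ c (is_derive1_ln x0))).
  rewrite ln1 mulr0 -mulrBl => E.
  suff : 0 <= (dp d - c) / d * (r - 1) by rewrite -E; lra.
  by rewrite mulr_ge0 ?divr_ge0 ?subr_ge0// ?dpressure_le//; lra.
(* [c * t] exceeds [M - enthalpy 1] by at least [c]; adding [|m|] to [expR t] also pushes [r] beyond
   [m]. *)
pose t := `|M - enthalpy 1| / c + 1.
have t1 : 1 <= t by rewrite /t lerDr divr_ge0// ltW.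
pose r := expR t + `|m|.
have e1 : 1 < expR t by rewrite expR_gt1; lra.
exists r.
  by rewrite /r (le_lt_trans (ler_norm m))// ltrDr expR_gt0.
have er : expR t <= r by rewrite lerDl.
have r1 : 1 < r by exact: lt_le_trans er.
have lr : t <= ln r by rewrite -[leLHS]expRK ler_ln// posrE; lra.
have := H _ r1; apply: lt_le_trans.
rewrite -ltrBlDl.
have : c * t <= c * ln r by rewrite ler_pM2l.
apply: lt_le_trans; rewrite /t mulrDr mulrCA mulfV ?gt_eqF//.
by have := ler_norm (M - enthalpy 1); lra.
Qed.

End Pressure.

(** * Subsonic roots of the Bernoulli equation *)

Section Bernoulli.
Context {R : realType} (p : R -> R).
Hypothesis hp : pressure_law p.
Local Notation dp := (derive1 p).
Local Notation h := (enthalpy hp).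

(* In [bernoulli], [subsonic] and [flow], [s] is the momentum and [r] the density. *)
Definition bernoulli (s r : R) : R := s ^+ 2 / (2 * r ^+ 2) + h r.

Definition subsonic (s r : R) : Prop := 0 < r /\ s ^+ 2 < r ^+ 2 * dp r.

Definition flow (s r : R) : R := s ^+ 2 / r + p r.

Lemma subsonic_ge (s r r' : R) : subsonic s r -> r <= r' -> subsonic s r'.
Proof.
move=> [r0 sr] rr'; have r'0 := lt_le_trans r0 rr'; split=> //.
apply: (lt_le_trans sr); apply: ler_pM; rewrite ?sqr_ge0//.
- exact/ltW/(dpressure_gt0 hp).
- by rewrite ler_sqr// nnegrE ltW.
- exact: (dpressure_le hp).
Qed.

Lemma subsonicN (s r : R) : subsonic s r -> subsonic (- s) r.
Proof. by rewrite /subsonic sqrrN. Qed.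

Lemma subsonic_sqr_le (s t r : R) : t ^+ 2 <= s ^+ 2 -> subsonic s r -> subsonic t r.
Proof. by move=> ts [r0 sr]; split=> //; apply: le_lt_trans sr. Qed.

Lemma is_derive_sqr_inv (c r : R) : r != 0 ->
  is_derive r 1 (fun r : R => c / (2 * r ^+ 2)) (- (c / r ^+ 3)).
Proof.
move=> r0.
have d1 : is_derive r 1 (fun r : R => r^-1) (- r ^- 2) by apply: is_derive_inv.
have d2 := is_deriveZ (c / 2) (is_deriveX 2 d1).
have -> : (fun r : R => c / (2 * r ^+ 2)) = (c / 2) *: (fun r : R => r^-1) ^+ 2.
  by apply/funext => z; rewrite /= !fctE /GRing.scale /= invfM mulrA exprVn.
apply: (is_derive_eq d2); rewrite /GRing.scale /= expr1; field.
by rewrite r0.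
Qed.

Lemma bernoulli_is_derive (s r : R) : 0 < r ->
  is_derive r 1 (bernoulli s) (dp r / r - s ^+ 2 / r ^+ 3).
Proof.
move=> r0; have rn0 : r != 0 by rewrite gt_eqF.
apply: (is_derive_eq (is_deriveD (is_derive_sqr_inv (s ^+ 2) rn0)
  (enthalpy_is_derive hp r0))).
by rewrite addrC.
Qed.

Lemma flow_is_derive (s r : R) : 0 < r ->
  is_derive r 1 (flow s) (dp r - s ^+ 2 / r ^+ 2).
Proof.
move=> r0; have rn0 : r != 0 by rewrite gt_eqF.
apply: (is_derive_eq (is_deriveD (is_deriveZ (s ^+ 2) (is_derive_inv rn0))
  (pressure_is_derive hp r0))).
by rewrite addrC /GRing.scale /= mulrN.
Qed.

Lemma subsonic_dflow_gt0 (s r : R) : subsonic s r -> 0 < dp r - s ^+ 2 / r ^+ 2.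
Proof.
by move=> [r0 sr]; rewrite subr_gt0 ltr_pdivrMr ?exprn_gt0// mulrC.
Qed.

(** Dividing the density derivative of [flow] by [r] gives that of [bernoulli], so both quantities
    increase on the same range. *)
Lemma subsonic_dbernoulli_gt0 (s r : R) : subsonic s r ->
  0 < dp r / r - s ^+ 2 / r ^+ 3.
Proof.
move=> sr; have r0 := sr.1.
have -> : dp r / r - s ^+ 2 / r ^+ 3 = (dp r - s ^+ 2 / r ^+ 2) / r.
  by field; rewrite gt_eqF.
by rewrite divr_gt0// subsonic_dflow_gt0.
Qed.

Lemma bernoulli_lt (s r r' : R) : subsonic s r -> r < r' ->
  bernoulli s r < bernoulli s r'.
Proof.
move=> sr rr'; rewrite -subr_gt0.
have [x /andP[rx _]|c /andP[rc _] ->] :=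
  @mean_value _ (bernoulli s) (fun x => dp x / x - s ^+ 2 / x ^+ 3) _ _ rr'.
  by apply: bernoulli_is_derive; exact: lt_le_trans sr.1 rx.
apply: mulr_gt0; last by rewrite subr_gt0.
exact/subsonic_dbernoulli_gt0/(subsonic_ge sr)/ltW.
Qed.

Lemma flow_lt (s r r' : R) : subsonic s r -> r < r' -> flow s r < flow s r'.
Proof.
move=> sr rr'; rewrite -subr_gt0.
have [x /andP[rx _]|c /andP[rc _] ->] :=
  @mean_value _ (flow s) (fun x => dp x - s ^+ 2 / x ^+ 2) _ _ rr'.
  by apply: flow_is_derive; exact: lt_le_trans sr.1 rx.
apply: mulr_gt0; last by rewrite subr_gt0.
exact/subsonic_dflow_gt0/(subsonic_ge sr)/ltW.
Qed.

Lemma bernoulli_inj (s r r' : R) : subsonic s r -> subsonic s r' ->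
  bernoulli s r = bernoulli s r' -> r = r'.
Proof.
move=> sr sr' E; have [rr'|rr'|//] := ltgtP r r'.
  by have := bernoulli_lt sr rr'; rewrite E ltxx.
by have := bernoulli_lt sr' rr'; rewrite E ltxx.
Qed.

Lemma flow_inj (s r r' : R) : subsonic s r -> subsonic s r' ->
  flow s r = flow s r' -> r = r'.
Proof.
move=> sr sr' E; have [rr'|rr'|//] := ltgtP r r'.
  by have := flow_lt sr rr'; rewrite E ltxx.
by have := flow_lt sr' rr'; rewrite E ltxx.
Qed.

Definition root_of (s e r : R) : Prop := subsonic s r /\ bernoulli s r = e.

Definition solvable (s e : R) : Prop := exists r, root_of s e r.

(** By [bernoulli_inj] at most one value qualifies; where the equation is not solvable, [get]
    returns a meaningless default. *)
Definition subsonic_root (s e : R) : R := get (root_of s e).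

Lemma subsonic_rootE (s e r : R) : root_of s e r -> subsonic_root s e = r.
Proof.
move=> [sr br]; have [sg bg] : root_of s e (subsonic_root s e) by apply: getI; split; eauto.
by apply: bernoulli_inj sg sr _; rewrite bg br.
Qed.

Lemma subsonic_rootP (s e : R) : solvable s e -> root_of s e (subsonic_root s e).
Proof. by move=> [r H]; rewrite (subsonic_rootE H). Qed.

(** The intermediate value theorem solves the equation above the subsonic density [r], where
    [subsonic_ge] makes the solution subsonic. *)
Lemma bernoulli_between (s e r r' : R) : subsonic s r -> r <= r' ->
  bernoulli s r <= e <= bernoulli s r' -> exists2 c, r <= c <= r' & root_of s e c.
Proof.
move=> sr rr' /andP[re er'].
have [||c] := @IVT R (bernoulli s) r r' e rr'.
- apply: derivable_within_continuous => x; rewrite in_itv /= => /andP[rx _].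
  by have [] := bernoulli_is_derive s (lt_le_trans sr.1 rx).
- by rewrite ge_min le_max re er' orbT.
rewrite in_itv /= => /andP[rc cr'] bc; exists c; first by rewrite rc.
by split=> //; apply: subsonic_ge sr rc.
Qed.

(** A smaller [|s|] keeps [r] subsonic and brings its Bernoulli quantity to at most [e], while the
    unbounded enthalpy overtakes [e] further up. Hence stationary states continue to all larger
    sections. *)
Lemma solvable_sqr_le (s t e : R) : t ^+ 2 <= s ^+ 2 -> solvable s e -> solvable t e.
Proof.
move=> ts [r [sr br]].
have [r' rr' er'] := enthalpy_unbounded hp r e.
have [||c _ ?] := @bernoulli_between t e r r' _ (ltW rr').
- exact: subsonic_sqr_le sr.
- apply/andP; split.
    by rewrite -br /bernoulli lerD2r ler_wpM2r// invr_ge0 mulr_ge0// sqr_ge0.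
  apply/ltW/(lt_le_trans er'); rewrite /bernoulli lerDr.
  by apply: divr_ge0; [exact: sqr_ge0|apply: mulr_ge0 => //; exact: sqr_ge0].
by exists c.
Qed.

Lemma continuous_sqr (T : topologicalType) (s : T -> R) (x : T) :
  {for x, continuous s} -> {for x, continuous (fun y => s y ^+ 2)}.
Proof.
move=> cs; apply: (@continuous_comp _ _ _ s (fun z => z ^+ 2)) => //.
exact: exprn_continuous.
Qed.

Lemma bernoulli_continuous_speed (T : topologicalType) (s : T -> R) (r : R) (x : T) :
  {for x, continuous s} -> {for x, continuous (fun y => bernoulli (s y) r)}.
Proof.
move=> cs; apply: (@continuousD _ _ _ (fun y => s y ^+ 2 / (2 * r ^+ 2)) (fun=> h r)).
  apply: (@continuousM _ _ (fun y => s y ^+ 2) (fun=> (2 * r ^+ 2)^-1));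
    last exact: cst_continuous.
  exact: continuous_sqr.
exact: cst_continuous.
Qed.

(** Strict monotonicity brackets the root between [r - m] and [r + m] with strict inequalities at
    [x], which persist nearby. This yields both solvability near [x] and continuity of the root. *)
Lemma near_root (T : topologicalType) (s e : T -> R) (x : T) (r eps : R) :
  {for x, continuous s} -> {for x, continuous e} -> root_of (s x) (e x) r -> 0 < eps ->
  \forall y \near x, exists2 r', `|r - r'| < eps & root_of (s y) (e y) r'.
Proof.
move=> cs ce [[r0 sr] br] eps0.
have cf : {for r, continuous (fun z : R => z ^+ 2 * dp z)}.
  apply: (@continuousM _ _ (fun z : R => z ^+ 2) dp); first exact: exprn_continuous.
  exact: dpressure_continuous hp _ _.
have H1 : \forall z \near r, s x ^+ 2 < z ^+ 2 * dp z.
  by apply: (@near_lt _ _ (fun=> s x ^+ 2) (fun z : R => z ^+ 2 * dp z)) => //;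
    exact: cst_continuous.
have H2 : \forall z \near r, 0 < z by apply: lt_nbhsr.
have [d /= d0 Hd] : nbhs_ball r (fun z : R => 0 < z /\ s x ^+ 2 < z ^+ 2 * dp z).
  by apply/nbhs_ballP; move: H1 H2; apply: filterS2.
(* [m < d] keeps [r - m] subsonic; [m < eps] puts the bracketed root within [eps] of [r]. *)
pose m := Num.min d eps / 2.
have dm : 0 < Num.min d eps by rewrite lt_min d0.
have md : m < d by rewrite /m; have : Num.min d eps <= d; [by rewrite ge_min lexx|lra].
have me : m < eps.
  by rewrite /m; have : Num.min d eps <= eps; [by rewrite ge_min lexx orbT|lra].
have m0 : 0 < m by rewrite /m; lra.
have [r10 sr1] : 0 < r - m /\ s x ^+ 2 < (r - m) ^+ 2 * dp (r - m).
  by apply: Hd; rewrite /ball /= subKr gtr0_norm.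
have N1 : \forall y \near x, s y ^+ 2 < (r - m) ^+ 2 * dp (r - m).
  by apply: (@near_lt _ _ (fun y => s y ^+ 2) (fun=> (r - m) ^+ 2 * dp (r - m))) => //;
    [exact: continuous_sqr|exact: cst_continuous].
have N2 : \forall y \near x, bernoulli (s y) (r - m) < e y.
  apply: (@near_lt _ _ (fun y => bernoulli (s y) (r - m)) e) => //;
    first exact: bernoulli_continuous_speed.
  by rewrite -br; apply: bernoulli_lt; [split|rewrite ltrBlDr ltrDl].
have N3 : \forall y \near x, e y < bernoulli (s y) (r + m).
  apply: (@near_lt _ _ e (fun y => bernoulli (s y) (r + m))) => //;
    first exact: bernoulli_continuous_speed.
  by rewrite -br; apply: bernoulli_lt; [split|rewrite ltrDl].
near=> y.
have [||| c /andP[c1 c2] Hc] := @bernoulli_between (s y) (e y) (r - m) (r + m).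
- by split=> //; near: y.
- lra.
- by apply/andP; split; apply/ltW; near: y.
by exists c => //; rewrite ltr_norml; apply/andP; split; lra.
Unshelve. all: by end_near. Qed.

Lemma near_solvable (T : topologicalType) (s e : T -> R) (x : T) :
  {for x, continuous s} -> {for x, continuous e} -> solvable (s x) (e x) ->
  \forall y \near x, solvable (s y) (e y).
Proof.
move=> cs ce [r xr]; have := near_root cs ce xr ltr01.
by apply: filterS => y [r' _ ?]; exists r'.
Qed.

Lemma subsonic_root_continuous (T : topologicalType) (s e : T -> R) (x : T) :
  {for x, continuous s} -> {for x, continuous e} -> solvable (s x) (e x) ->
  {for x, continuous (fun y => subsonic_root (s y) (e y))}.
Proof.
move=> cs ce sx; apply/cvgrPdist_lt => eps eps0.
have := near_root cs ce (subsonic_rootP sx) eps0.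
by apply: filterS => y [r' rr' /subsonic_rootE ->].
Qed.

Local Notation root := subsonic_root.

(** Implicit differentiation of [s ^+ 2 / (2 * rho ^+ 2) + h rho = e]: the increment of the root is
    a combination of those of [e] and [s] with coefficients continuous at [x], to which
    [is_diff_caratheodory] applies. *)
Lemma subsonic_root_is_diff (V : normedModType R) (s e : V -> R) (x : V) :
  differentiable s x -> differentiable e x ->
  (\forall y \near x, solvable (s y) (e y)) ->
  let r := root (s x) (e x) in
  is_diff x (fun y => root (s y) (e y))
    ((dp r / r - s x ^+ 2 / r ^+ 3)^-1 *:
      (('d e x : V -> R) - (s x / r ^+ 2) *: ('d s x : V -> R))).
Proof.
move=> ds de sol r.
have cs := differentiable_continuous ds.
have ce := differentiable_continuous de.
have solx := nbhs_singleton sol.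
pose rho y := root (s y) (e y).
have cr : {for x, continuous rho} by apply: subsonic_root_continuous.
have [srx brx] := subsonic_rootP solx.
have rx0 : 0 < r := srx.1.
(* [q] is the slope function of the enthalpy at [r]: it makes the increment of [h] an exact multiple
   of that of the root. *)
have [q [hq cq qr]] : exists q, [/\ forall z, h z - h r = q z * (z - r),
    {for r, continuous q} & q r = dp r / r].
  by apply/is_derive1_caratheodory; exact: enthalpy_is_derive.
(* Subtracting the two Bernoulli equations gives
   [e y - e x = (s y + s x) / (2 * rho y ^+ 2) * (s y - s x) + K y * (rho y - r)]. *)
pose K y := q (rho y) - s x ^+ 2 * (r + rho y) / (2 * rho y ^+ 2 * r ^+ 2).
have cV : {for x, continuous (fun y => (2 * rho y ^+ 2)^-1)}.
  apply: (@continuousV _ _ (fun y => 2 * rho y ^+ 2)).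
    by rewrite mulf_neq0 ?sqrf_eq0 ?gt_eqF.
  apply: (@continuousM _ _ (fun=> 2) (fun y => rho y ^+ 2)); first exact: cst_continuous.
  exact: continuous_sqr.
have cK : {for x, continuous K}.
  apply: (@continuousB _ _ _ (q \o rho)
    (fun y => s x ^+ 2 * (r + rho y) / (2 * rho y ^+ 2 * r ^+ 2))).
    exact: continuous_comp.
  have -> : (fun y => s x ^+ 2 * (r + rho y) / (2 * rho y ^+ 2 * r ^+ 2)) =
     (fun y => (s x ^+ 2 / r ^+ 2 * (r + rho y)) * (2 * rho y ^+ 2)^-1).
    apply/funext => y; rewrite invfM; ring.
  apply: (@continuousM _ _ (fun y => s x ^+ 2 / r ^+ 2 * (r + rho y))) => //.
  apply: (@continuousM _ _ (fun=> s x ^+ 2 / r ^+ 2) (fun y => r + rho y)).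
    exact: cst_continuous.
  by apply: (@continuousD _ _ _ (fun=> r) rho) => //; exact: cst_continuous.
have rhox : rho x = r by [].
have Kx : K x = dp r / r - s x ^+ 2 / r ^+ 3.
  by rewrite /K rhox qr; field; rewrite gt_eqF.
have Kx0 : K x != 0 by rewrite Kx gt_eqF// subsonic_dbernoulli_gt0.
have Kn0 : \forall y \near x, K y != 0 by exact: (cvgr_neq0 _ cK).
have cKV : {for x, continuous (fun y => (K y)^-1)} by exact: continuousV.
pose B y := - ((K y)^-1 * ((s y + s x) * (2 * rho y ^+ 2)^-1)).
have cB : {for x, continuous B}.
  apply: (@continuousN _ _ _ (fun y => (K y)^-1 * ((s y + s x) * (2 * rho y ^+ 2)^-1))).
  apply: (@continuousM _ _ (fun y => (K y)^-1)) => //.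
  apply: (@continuousM _ _ (fun y => s y + s x)) => //.
  by apply: (@continuousD _ _ _ s (fun=> s x)) => //; exact: cst_continuous.
pose f1 y := (K y)^-1 * (e y - e x).
pose f2 y := B y * (s y - s x).
have d1 : is_diff x f1 ((K x)^-1 *: ('d e x : V -> R)).
  apply: (@is_diff_caratheodory _ _ (fun y => (K y)^-1)) => //.
  by apply: nearW => y; rewrite /f1 subrr mulr0 subr0.
have d2 : is_diff x f2 (B x *: ('d s x : V -> R)).
  apply: (@is_diff_caratheodory _ _ B) => //.
  by apply: nearW => y; rewrite /f2 subrr mulr0 subr0.
have d12 := is_diffD (is_diffD d1 d2) (is_diff_cst r x).
have E : \forall y \near x, f1 y + f2 y + r = rho y.
  near=> y.
  have Ky : K y != 0 by near: y.
  have [sry bry] : root_of (s y) (e y) (rho y) by apply: subsonic_rootP; near: y.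
  have ry0 : 0 < rho y := sry.1.
  suff Q : e y - e x = (s y + s x) / (2 * rho y ^+ 2) * (s y - s x) + K y * (rho y - r).
    by rewrite /f1 /f2 /B Q; field; rewrite Ky gt_eqF.
  rewrite -bry -brx /bernoulli -/r.
  have -> : s y ^+ 2 / (2 * rho y ^+ 2) + h (rho y) - (s x ^+ 2 / (2 * r ^+ 2) + h r) =
    s y ^+ 2 / (2 * rho y ^+ 2) - s x ^+ 2 / (2 * r ^+ 2) + (h (rho y) - h r) by ring.
  by rewrite hq /K; field; rewrite !gt_eqF.
have := near_eq_is_diff E d12; move/is_diff_eq; apply.
rewrite addr0 Kx /B Kx -/r -/(rho x).
apply/funext => v; rewrite !fctE /= /GRing.scale /= /rho -/r.
move: (_^-1) => k; field; rewrite gt_eqF.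
Unshelve. all: by end_near. Qed.

(** The formula of [subsonic_root_is_diff] holds at all points near [x]; its coefficients are
    continuous at [x] because the root is and because [K x] is positive. *)
Lemma subsonic_root_C1 (V : normedModType R) (s e : V -> R) (x : V) :
  C1_at s x -> C1_at e x -> solvable (s x) (e x) ->
  C1_at (fun y => root (s y) (e y)) x.
Proof.
move=> Cs Ce solx.
have cs := C1_at_continuous Cs; have ce := C1_at_continuous Ce.
have cr := subsonic_root_continuous cs ce solx.
have sol := near_solvable cs ce solx.
case: Cs Ce => [ds d1 c1] [de d2 c2].
pose rho y := root (s y) (e y).
pose K y := dp (rho y) / rho y - s y ^+ 2 / rho y ^+ 3.
exists (fun y => (K y)^-1 *: (de y - (s y / rho y ^+ 2) *: ds y)).
  move/near_join: sol; apply: filterS3 d1 d2 => y [h1 h1e] [h2 h2e] soly.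
  by rewrite -h1e -h2e; apply: subsonic_root_is_diff.
have [srx brx] := subsonic_rootP solx; have r0 : 0 < rho x := srx.1.
have cX n : {for x, continuous (fun y => (rho y ^+ n)^-1)}.
  apply: (@continuousV _ _ (fun y => rho y ^+ n)); first by rewrite expf_neq0// gt_eqF.
  by apply: (@continuous_comp _ _ _ rho (fun z => z ^+ n)) => //; exact: exprn_continuous.
have cK : {for x, continuous K}.
  apply: (@continuousB _ _ _ (fun y => dp (rho y) / rho y)
    (fun y => s y ^+ 2 / rho y ^+ 3)).
    apply: (@continuousM _ _ (dp \o rho) (fun y => (rho y)^-1)); last exact: (cX 1).
    apply: continuous_comp => //; exact: (dpressure_continuous hp).
  apply: (@continuousM _ _ (fun y => s y ^+ 2)); [exact: continuous_sqr|exact: cX].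
move=> v.
apply: (@continuousM _ _ (fun y => (K y)^-1)
  (fun y => de y v - (s y / rho y ^+ 2) * ds y v)).
  apply: continuousV => //; by rewrite gt_eqF// subsonic_dbernoulli_gt0.
apply: (@continuousB _ _ _ (fun y => de y v) (fun y => (s y / rho y ^+ 2) * ds y v)) => //.
apply: (@continuousM _ _ (fun y => s y / rho y ^+ 2)) => //.
exact: (@continuousM _ _ s).
Qed.

End Bernoulli.

(** * Stationary solutions *)

Section Stationary.
Context {R : realType} (p : R -> R).
Hypothesis hp : pressure_law p.
Local Notation dp := (derive1 p).
Local Notation h := (enthalpy hp).
Local Notation root := (subsonic_root hp).

Lemma density_vec2 (x y : R) : density (vec2 x y) = x.
Proof. by rewrite /density /vec2 mxE eqxx. Qed.

Lemma momentum_vec2 (x y : R) : momentum (vec2 x y) = y.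
Proof. by rewrite /momentum /vec2 mxE. Qed.

Lemma vec2_eta (u : 'rV[R]_2) : vec2 (density u) (momentum u) = u.
Proof.
apply/rowP => j; rewrite mxE /density /momentum; case: j => -[|[|//]] i.
  by congr (u _ _); apply/val_inj.
by congr (u _ _); apply/val_inj.
Qed.

Lemma vec2_inj (x y x' y' : R) : vec2 x y = vec2 x' y' -> x = x' /\ y = y'.
Proof.
move=> E; split.
  by rewrite -(density_vec2 x y) E density_vec2.
by rewrite -(momentum_vec2 x y) E momentum_vec2.
Qed.

Lemma momentum_flowE (u : 'rV[R]_2) : momentum_flow p u = flow p (momentum u) (density u).
Proof. by []. Qed.

(** The two sign conditions together say that [|q / r|] is less than the square root of [dp r];
    squaring removes the root. *)
Lemma A0P (u : 'rV[R]_2) : A0 p u <-> subsonic p (momentum u) (density u).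
Proof.
rewrite /A0 /= /lambda1 /lambda2 /subsonic; set q := momentum u; set r := density u.
have main : 0 < r -> (q / r - Num.sqrt (dp r) < 0 /\ 0 < q / r + Num.sqrt (dp r)) <->
    q ^+ 2 < r ^+ 2 * dp r.
  move=> r0; have d0 := dpressure_gt0 hp r0.
  have -> : (q ^+ 2 < r ^+ 2 * dp r) = (`|q / r| < Num.sqrt (dp r)).
    rewrite -[in RHS]ltr_sqr ?nnegrE ?sqrtr_ge0// sqr_sqrtr ?ltW//.
    by rewrite real_normK ?num_real// expr_div_n ltr_pdivrMr ?exprn_gt0// mulrC.
  rewrite ltr_norml subr_lt0; split.
    by move=> [-> ?]; rewrite andbT; lra.
  by move=> /andP[? ->]; split=> //; lra.
split=> [[r0 l1 l2]|[r0 H]]; first by split=> //; apply/main.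
by have [l1 l2] := (main r0).2 H.
Qed.

Lemma is_derive_flow (r q : R -> R) (b dr dq : R) : 0 < r b ->
  is_derive b 1 r dr -> is_derive b 1 q dq ->
  is_derive b 1 (fun c => flow p (q c) (r c))
    (2 * q b * dq / r b + (dp (r b) - q b ^+ 2 / r b ^+ 2) * dr).
Proof.
move=> r0 hr hq; have rn0 : r b != 0 by rewrite gt_eqF.
have dP := @is_derive1_comp _ _ _ _ _ _ (pressure_is_derive hp r0) hr.
have dV := @is_derive1_comp _ _ _ _ _ _ (is_derive_inv rn0) hr.
apply: (is_derive_eq (is_deriveD (is_deriveM (is_deriveM hq hq) dV) dP)).
by rewrite /GRing.scale /= !fctE; field.
Qed.

Lemma is_derive_bernoulli (r q : R -> R) (b dr dq : R) : 0 < r b ->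
  is_derive b 1 r dr -> is_derive b 1 q dq ->
  is_derive b 1 (fun c => bernoulli hp (q c) (r c))
    (q b * dq / r b ^+ 2 + (dp (r b) / r b - q b ^+ 2 / r b ^+ 3) * dr).
Proof.
move=> r0 hr hq; have rn0 : r b != 0 by rewrite gt_eqF.
have dH := @is_derive1_comp _ _ _ _ _ _ (enthalpy_is_derive hp r0) hr.
have dV := @is_derive1_comp _ _ _ _ _ _ (is_derive_sqr_inv 1 rn0) hr.
have -> : (fun c => bernoulli hp (q c) (r c)) =
   q * q * ((fun r : R => 1 / (2 * r ^+ 2)) \o r) + (h \o r).
  by apply/funext => c; rewrite /bernoulli !fctE /= mul1r expr2.
apply: (is_derive_eq (is_deriveD (is_deriveM (is_deriveM hq hq) dV) dH)).
by rewrite /GRing.scale /= !fctE /=; field.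
Qed.

(** The equation for [q] gives the conserved discharge, and the momentum balance then gives [key].
    From [key] follow the conservation of the Bernoulli quantity and the absence of sonic points,
    hence subsonicity by continuity. *)
Lemma stationary_invariants (al a : R) (ul : 'rV[R]_2) (r q : R -> R) :
  A0 p ul -> stationary_solution p al ul a r q ->
  exists lo hi : R, [/\ 0 <= lo, lo < al < hi, lo < a < hi &
    forall b : R, lo < b < hi ->
      [/\ q b = al * momentum ul / b,
          root_of hp (q b) (bernoulli hp (momentum ul) (density ul)) (r b),
          derivable r b 1 &
          is_derive b 1 (fun c => c * flow p (q c) (r c)) (p (r b))]].
Proof.
move=> /A0P sul [ral qal [lo [hi [lo0 lal la H]]]].
exists lo, hi; split=> //.
have pos b : lo < b < hi -> 0 < b by move=> /andP[lb _]; exact: le_lt_trans lb.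
have al0 := pos _ lal.
have mass b : lo < b < hi -> q b = al * momentum ul / b.
  move=> lb; have b0 := pos _ lb.
  suff E : b * q b = al * q al by rewrite -qal -E; field; rewrite gt_eqF.
  apply: (@derive0_eq _ (fun b => b * q b) lo hi) => // c lc.
  have [_ _ dq _] := H _ lc; have c0 := pos _ lc.
  apply: (is_derive_eq (is_deriveM (is_derive_id c 1) dq)).
  by rewrite /GRing.scale /=; field; rewrite gt_eqF.
pose dr b := 'D_1 r b.
(* In the derivative of [b * P] the pressure cancels against the source [p (r b)], and the terms
   without [dr b] add up to [- (q b ^+ 2 / r b)]. *)
have key b : lo < b < hi -> b * (dp (r b) - q b ^+ 2 / r b ^+ 2) * dr b = q b ^+ 2 / r b.
  move=> lb; have [r0 /derivableP hr dq [_ dP]] := H _ lb; have b0 := pos _ lb.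
  have := is_deriveM (is_derive_id b 1) (is_derive_flow r0 hr dq).
  have -> : id * (fun c => flow p (q c) (r c)) =
      (fun c => c * momentum_flow p (vec2 (r c) (q c))).
    by apply/funext => c; rewrite momentum_flowE density_vec2 momentum_vec2.
  move=> [_]; rewrite dP /GRing.scale /= /flow -/(dr b).
  set X := _ * dr b.
  have -> : b * (2 * q b * - (q b / b) / r b + X) = - (2 * q b ^+ 2 / r b) + b * X.
    by field; rewrite !gt_eqF.
  by rewrite /X !mulr1 => E; lra.
have bern b : lo < b < hi ->
    bernoulli hp (q b) (r b) = bernoulli hp (momentum ul) (density ul).
  move=> lb; rewrite -qal -ral.
  apply: (@derive0_eq _ (fun b => bernoulli hp (q b) (r b)) lo hi) => // c lc.
  have [r0 /derivableP hr dq _] := H _ lc; have c0 := pos _ lc.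
  apply: (is_derive_eq (is_derive_bernoulli r0 hr dq)).
  rewrite -/(dr c).
  have -> : (dp (r c) / r c - q c ^+ 2 / r c ^+ 3) * dr c =
      (c * (dp (r c) - q c ^+ 2 / r c ^+ 2) * dr c) / (r c * c).
    by field; rewrite !gt_eqF.
  by rewrite key//; field; rewrite !gt_eqF.
have sub b : lo < b < hi -> subsonic p (q b) (r b).
  move=> lb; have [rb0 _ _ _] := H _ lb; split=> //.
  (* A state at rest is subsonic at every positive density; the sign argument for the other case
     needs a nonzero discharge. *)
  have [q0|q0] := eqVneq (momentum ul) 0.
    by rewrite mass// q0 mulr0 mul0r expr0n mulr_gt0 ?exprn_gt0// (dpressure_gt0 hp).
  pose f b := r b ^+ 2 * dp (r b) - q b ^+ 2.
  (* By [key] a sonic point would force [q = 0]; hence [f] keeps its sign. *)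
  have fn0 c : lo < c < hi -> f c != 0.
    move=> lc; have [r0 _ _ _] := H _ lc; have c0 := pos _ lc.
    apply/eqP => fc; have := key _ lc.
    have -> : dp (r c) - q c ^+ 2 / r c ^+ 2 = f c / r c ^+ 2.
      by rewrite /f; field; rewrite gt_eqF.
    rewrite fc mul0r mulr0 mul0r => /esym/eqP.
    rewrite mulf_eq0 invr_eq0 sqrf_eq0 (gt_eqF r0) orbF mass//.
    by rewrite !mulf_eq0 invr_eq0 (negbTE q0) !gt_eqF.
  have cf c : lo < c < hi -> {for c, continuous f}.
    move=> lc;
    have [r0 /derivableP/is_derive_continuous cr /is_derive_continuous cq _] := H _ lc.
    apply: (@continuousB _ _ _ (fun b => r b ^+ 2 * dp (r b)) (fun b => q b ^+ 2)).
      apply: (@continuousM _ _ (fun b => r b ^+ 2) (dp \o r)); first exact: continuous_sqr.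
      by apply: continuous_comp => //; exact: (dpressure_continuous hp).
    exact: continuous_sqr.
  have fal : 0 < f al by rewrite /f ral qal subr_gt0 sul.2.
  rewrite -subr_gt0 -/(f b) ltNge; apply/negP => fb.
  (* [f] is positive at [al] and would be nonpositive at [b]; intermediate values on the segment
     between them, in either order, contradict [fn0]. *)
  have noroot x y : x <= y -> lo < x < hi -> lo < y < hi ->
      Num.min (f x) (f y) <= 0 <= Num.max (f x) (f y) -> False.
    move=> xy /andP[lx _] /andP[_ yh] I.
    have inI c : c \in `[x, y] -> lo < c < hi.
      by rewrite in_itv /= => /andP[xc cy]; rewrite (lt_le_trans lx xc) (le_lt_trans cy yh).
    have [|c /inI lc /eqP] := @IVT R f x y 0 xy _ I; last by rewrite (negbTE (fn0 _ lc)).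
    by apply: continuous_in_subspaceT => c; rewrite inE => /inI /cf.
  have [ab|/ltW ba] := leP al b.
    by apply: (noroot _ _ ab) => //; rewrite ge_min le_max fb (ltW fal) orbT.
  by apply: (noroot _ _ ba) => //; rewrite ge_min le_max fb (ltW fal) orbT.
move=> b lb; have [_ db _ dP] := H _ lb.
split; [exact: mass|by split; [exact: sub|exact: bern]|by []|].
have -> : (fun c => c * flow p (q c) (r c)) =
    (fun c => c * momentum_flow p (vec2 (r c) (q c))).
  by apply/funext => c; rewrite momentum_flowE density_vec2 momentum_vec2.
exact: dP.
Qed.

Lemma stationary_solvable (al a : R) (ul : 'rV[R]_2) (r q : R -> R) :
  A0 p ul -> stationary_solution p al ul a r q ->
  root_of hp (al * momentum ul / a) (bernoulli hp (momentum ul) (density ul)) (r a).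
Proof.
move=> Au /(stationary_invariants Au)[lo [hi [_ _ la /(_ _ la)[<- ? _ _]]]].
by [].
Qed.

(** The solution is [q = k / b] with the subsonic root as density. The equation is solvable at the
    smaller of the two sections, slightly below it by openness, and everywhere above it since
    [(k / b) ^+ 2] does not increase. *)
Lemma stationary_exists (al a : R) (ul : 'rV[R]_2) : 0 < al -> 0 < a -> A0 p ul ->
  solvable hp (al * momentum ul / a) (bernoulli hp (momentum ul) (density ul)) ->
  exists r q, stationary_solution p al ul a r q.
Proof.
move=> al0 a0 /A0P sul sa.
set k := al * momentum ul; set e := bernoulli hp _ _ in sa *.
have k_al : k / al = momentum ul by rewrite /k; field; rewrite gt_eqF.
have sal : solvable hp (k / al) e by exists (density ul); rewrite k_al.
pose m := Num.min al a.
have m0 : 0 < m by rewrite lt_min al0.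
have sm : solvable hp (k / m) e by rewrite /m; case: ltP.
have cq (b : R) : 0 < b -> is_derive b 1 (fun c : R => k / c) (- (k / b / b)).
  move=> b0; have bn0 : b != 0 by rewrite gt_eqF.
  apply: (is_derive_eq (is_deriveZ k (is_derive_inv bn0))).
  by rewrite /GRing.scale /=; field.
have ce (b : R) : {for b, continuous (fun=> e : R)} by exact: cst_continuous.
have [d /= d0 Hd] : nbhs_ball m (fun b : R => 0 < b /\ solvable hp (k / b) e).
  apply/nbhs_ballP.
  have N1 : \forall b \near m, 0 < b by apply: lt_nbhsr.
  have N2 := near_solvable (is_derive_continuous (cq _ m0)) (ce m) sm.
  by move: N1 N2; apply: filterS2.
(* [d / 2] stays strictly inside the ball where the equation is solvable, and the maximum with 0
   keeps sections positive. Any number above [al] and [a] can serve as [hi]. *)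
pose lo := Num.max 0 (m - d / 2).
have lom : lo < m by rewrite gt_max m0; lra.
have mal : m <= al by rewrite ge_min lexx.
have ma : m <= a by rewrite ge_min lexx orbT.
pose hi := al + a.
have dom (b : R) : lo < b -> 0 < b /\ solvable hp (k / b) e.
  rewrite gt_max => /andP[b0 mb]; split=> //.
  have [mb'|bm] := leP m b.
    apply: solvable_sqr_le sm; rewrite !expr_div_n ler_wpM2l ?sqr_ge0//.
    by rewrite lef_pV2 ?posrE ?exprn_gt0// ler_sqr// nnegrE ltW.
  by apply: (Hd b _).2; rewrite /ball /= gtr0_norm; lra.
exists (fun b => root (k / b) e), (fun b => k / b); split.
- by apply: subsonic_rootE; rewrite k_al.
- by [].
- exists lo, hi; split.
  + by rewrite le_max lexx.
  + by rewrite (lt_le_trans lom mal) /hi; lra.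
  + by rewrite (lt_le_trans lom ma) /hi; lra.
move=> b /andP[/dom[b0 sb] _].
have [[r0 sr] br] := subsonic_rootP sb.
have dq := cq b b0.
have Ns : \forall c \near b, solvable hp (k / c) e.
  exact: near_solvable (is_derive_continuous dq) (ce b) sb.
have dqd : differentiable (fun c : R => k / c) b by apply/derivable1_diffP; case: dq.
have dfr := subsonic_root_is_diff dqd (differentiable_cst e b) Ns.
have hr : is_derive b 1 (fun c : R => root (k / c) e)
    ((dp (root (k / b) e) / root (k / b) e - (k / b) ^+ 2 / root (k / b) e ^+ 3)^-1 *
     (k / b / root (k / b) e ^+ 2 * (k / b / b))).
  have [dfr1 dfr2] := dfr.
  have dqv : 'd (fun c : R => k / c) b 1 = - (k / b / b).
    by rewrite -derive1E'// derive1E; case: dq => _ ->.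
  apply: DeriveDef; first exact/derivable1_diffP.
  rewrite -derive1E derive1E'// dfr2 !fctE /= /GRing.scale /= diff_cst.
  by rewrite dqv sub0r !mulrN opprK.
split => //.
have -> : (fun c => c * momentum_flow p (vec2 (root (k / c) e) (k / c))) =
    (fun c => c * flow p (k / c) (root (k / c) e)).
  by apply/funext => c; rewrite momentum_flowE density_vec2 momentum_vec2.
apply: (is_derive_eq (is_deriveM (is_derive_id b 1)
  (@is_derive_flow (fun c => root (k / c) e) (fun c => k / c) _ _ _ r0 hr dq))).
set r := root _ _ in r0 sr br *.
have /lt0r_neq0 Kn0 := subsonic_dbernoulli_gt0 (conj r0 sr).
rewrite /GRing.scale /= /flow.
(* Factoring out [r] exhibits the quantity inverted in the derivative of the root, so that the two
   cancel. *)
have -> : dp r - (k / b) ^+ 2 / r ^+ 2 = r * (dp r / r - (k / b) ^+ 2 / r ^+ 3).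
  by field; rewrite !gt_eqF.
move: Kn0; set K := dp r / r - _ => Kn0.
by field; rewrite Kn0 !gt_eqF.
Qed.

Lemma oriented_integral_FTC (f F : R -> R) (lo hi a b : R) :
  lo < a < hi -> lo < b < hi ->
  (forall x : R, lo < x < hi -> is_derive x 1 F (f x)) ->
  (forall x : R, lo < x < hi -> {for x, continuous f}) ->
  oriented_integral f a b = F b - F a.
Proof.
move=> la lb dF cf.
have main x y : lo < x < hi -> lo < y < hi -> x < y ->
    \int[lebesgue_measure]_(t in `[x, y]) f t = F y - F x.
  move=> /andP[lx _] /andP[_ yh] xy.
  have inI z : x <= z <= y -> lo < z < hi.
    by move=> /andP[xz zy]; rewrite (lt_le_trans lx xz) (le_lt_trans zy yh).
  have xI : lo < x < hi by apply: inI; rewrite lexx ltW.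
  have yI : lo < y < hi by apply: inI; rewrite lexx ltW.
  rewrite /Rintegral (@continuous_FTC2 R f F x y xy)//.
  - by apply: continuous_in_subspaceT => z; rewrite inE /= in_itv /= => /inI /cf.
  - split.
    + move=> z; rewrite in_itv /= => /andP[xz zy].
      by case: (dF z); first by apply: inI; rewrite !ltW.
    + exact/cvg_at_right_filter/is_derive_continuous/dF.
    + exact/cvg_at_left_filter/is_derive_continuous/dF.
  - move=> z; rewrite in_itv /= => /andP[xz zy].
    by rewrite derive1E; case: (dF z); first by apply: inI; rewrite !ltW.
rewrite /oriented_integral; have [ab|ba|<-] := ltgtP a b.
- exact: main.
- by rewrite main// opprB.
- by rewrite set_itv1 Rintegral_set1 subrr.
Qed.

(** [get] picks the value of some solution, but by [stationary_solvable] every solution equals the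
    subsonic root at [a], so the choice is immaterial. *)
Lemma stationary_densityE (al a : R) (ul : 'rV[R]_2) (r q : R -> R) : A0 p ul ->
  stationary_solution p al ul a r q ->
  stationary_density p al ul a =
    root (al * momentum ul / a) (bernoulli hp (momentum ul) (density ul)).
Proof.
move=> Au S.
have [r' [q' [S' <-]]] : [set y | exists r q : R -> R,
    stationary_solution p al ul a r q /\ r a = y] (stationary_density p al ul a).
  by apply: getI; exists r, q; split; [exact: S|reflexivity].
by rewrite (subsonic_rootE (stationary_solvable Au S')).
Qed.


(** The integrand is the derivative of [b * P] along the solution, so the integral is the increment
    of [b * P] between the two sections. *)
Lemma integral_stationary_density (al a : R) (ul : 'rV[R]_2) :
  A0 p ul -> (exists r q, stationary_solution p al ul a r q) ->
  let s := al * momentum ul / a in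
  oriented_integral (fun b => p (stationary_density p al ul b)) al a =
    a * flow p s (root s (bernoulli hp (momentum ul) (density ul))) -
    al * momentum_flow p ul.
Proof.
move=> Au [r [q S]] s.
have [ral qal [lo [hi [lo0 lal la H]]]] := S.
(* The pair [r], [q] solves the problem up to every section of its interval, not only up to [a]. *)
have Sb b : lo < b < hi -> stationary_solution p al ul b r q.
  by move=> lb; split=> //; exists lo, hi.
have Eb b : lo < b < hi -> q b = al * momentum ul / b /\
    root_of hp (q b) (bernoulli hp (momentum ul) (density ul)) (r b).
  by move=> /Sb /(stationary_invariants Au)[lo' [hi' [_ _ lb /(_ _ lb)[]]]].
have rE b : lo < b < hi -> stationary_density p al ul b = r b.
  move=> lb; rewrite (stationary_densityE Au (Sb _ lb)).
  by have [<- /subsonic_rootE] := Eb _ lb.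
have -> : a * flow p s (root s (bernoulli hp (momentum ul) (density ul))) =
    a * flow p (q a) (r a).
  by have [qa ra] := Eb _ la; rewrite /s -qa (subsonic_rootE ra).
rewrite momentum_flowE -ral -qal.
apply: (oriented_integral_FTC (F := fun b => b * flow p (q b) (r b)) lal la) => x lx.
  have [_ _ _] := H _ lx; rewrite rE//.
  have -> // : (fun c => c * flow p (q c) (r c)) =
      (fun c => c * momentum_flow p (vec2 (r c) (q c))).
  by apply/funext => c; rewrite momentum_flowE density_vec2 momentum_vec2.
have [rx0 /derivableP/is_derive_continuous cr _ _] := H _ lx.
have cpr : {for x, continuous (p \o r)}.
  by apply: continuous_comp => //; exact: (pressure_continuous hp).
rewrite /prop_for /continuous_at rE//; apply: cvg_trans cpr; apply: near_eq_cvg.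
have : \forall y \near x, y \in `]lo, hi[ by apply: near_in_itvoo; rewrite in_itv.
by apply: filterS => y; rewrite in_itv /= => /rE ->.
Qed.

End Stationary.

(** * Coordinates of junction arguments and invertible Jacobians *)

Section Coordinates.
Context {R : realType}.

Lemma momentum_linear : linear (momentum : 'rV[R]_2 -> R).
Proof. by move=> a u v; rewrite /momentum !mxE. Qed.

Lemma density_linear : linear (density : 'rV[R]_2 -> R).
Proof. by move=> a u v; rewrite /density !mxE. Qed.

Lemma momentum_continuous : continuous (momentum : 'rV[R]_2 -> R).
Proof. exact: coord_continuous. Qed.

Lemma density_continuous : continuous (density : 'rV[R]_2 -> R).
Proof. exact: coord_continuous. Qed.

Local Notation J := (junction_arg R).

Lemma C1_at_left_section (x : J) : C1_at (fun y : J => y.1.1) x.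
Proof.
apply: C1_at_linear => // y; apply: (@continuous_comp _ _ _ fst fst); exact: cvg_fst.
Qed.

Lemma C1_at_right_section (x : J) : C1_at (fun y : J => y.2.1) x.
Proof.
apply: C1_at_linear => // y; apply: (@continuous_comp _ _ _ snd fst);
  [exact: cvg_snd|exact: cvg_fst].
Qed.

Lemma C1_at_left_state (f : 'rV[R]_2 -> R) (x : J) : linear f -> continuous f ->
  C1_at (fun y : J => f y.1.2) x.
Proof.
move=> lf cf; apply: C1_at_linear; first by move=> a u v; rewrite -lf.
move=> y; apply: (@continuous_comp _ _ _ (fun y : J => y.1.2) f); last exact: cf.
apply: (@continuous_comp _ _ _ fst snd); [exact: cvg_fst|exact: cvg_snd].
Qed.

Lemma C1_at_right_state (f : 'rV[R]_2 -> R) (x : J) : linear f -> continuous f ->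
  C1_at (fun y : J => f y.2.2) x.
Proof.
move=> lf cf; apply: C1_at_linear; first by move=> a u v; rewrite -lf.
move=> y; apply: (@continuous_comp _ _ _ (fun y : J => y.2.2) f); last exact: cf.
apply: (@continuous_comp _ _ _ snd snd); exact: cvg_snd.
Qed.

Lemma vec2E (x y : R) : vec2 x y = x *: vec2 1 0 + y *: vec2 0 1.
Proof.
by apply/rowP => j; rewrite !mxE; case: ifP => _; rewrite ?mulr1 ?mulr0 ?addr0 ?add0r.
Qed.

Lemma C1_at_scalel (V W : normedModType R) (f : V -> R) (w : W) x :
  C1_at f x -> C1_at (fun y => f y *: w) x.
Proof.
move=> [df d1 c1]; exists (fun y v => df y v *: w).
  apply: filterS d1 => y [h1 h1e]; apply: DiffDef; first exact: differentiableZl.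
  by rewrite diffZl// h1e.
by move=> v; apply: continuousZr_tmp; exact: c1.
Qed.

Lemma C1_at_vec2 (V : normedModType R) (f g : V -> R) x :
  C1_at f x -> C1_at g x -> C1_at (fun y => vec2 (f y) (g y)) x.
Proof.
move=> Cf Cg; have := C1_atD (C1_at_scalel (vec2 1 0) Cf) (C1_at_scalel (vec2 0 1) Cg).
by apply: C1_at_near; apply: nearW => y; rewrite -vec2E.
Qed.

Lemma is_diff_vec2 (V : normedModType R) (f g df dg : V -> R) x :
  is_diff x f df -> is_diff x g dg ->
  is_diff x (fun y => vec2 (f y) (g y)) (fun v => vec2 (df v) (dg v)).
Proof.
move=> [d1 e1] [d2 e2].
have h1 : is_diff x (fun y => f y *: vec2 1 0) (fun v => df v *: vec2 1 0 : 'rV[R]_2).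
  by apply: DiffDef; [exact: differentiableZl|rewrite diffZl// e1].
have h2 : is_diff x (fun y => g y *: vec2 0 1) (fun v => dg v *: vec2 0 1 : 'rV[R]_2).
  by apply: DiffDef; [exact: differentiableZl|rewrite diffZl// e2].
rewrite (_ : (fun y => vec2 (f y) (g y)) =
    (fun y => f y *: vec2 1 0) + (fun y => g y *: vec2 0 1)); last first.
  by apply/funext => y; rewrite vec2E.
apply: (is_diff_eq (is_diffD h1 h2)).
by apply/funext => v; rewrite [RHS]vec2E.
Qed.

(** The Jacobian is triangular: the first component sees only the momentum, so a kernel vector has
    zero momentum, and then zero density because [c1 * alpha] is nonzero. Equality near [u] is
    enough, which suits (S), whose closed formula holds only on an open domain. *)
Lemma jacobian_unit (f : 'rV[R]_2 -> 'rV[R]_2) (T : 'rV[R]_2 -> R)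
    (u : 'rV[R]_2) (c0 c1 c2 a alpha beta : R) :
  a != 0 -> c1 != 0 -> alpha != 0 ->
  is_diff u T (fun v => alpha * density v + beta * momentum v) ->
  (\forall w \near u, vec2 (a * momentum w - c0) (c1 * T w - c2) = f w) ->
  jacobian f u \in unitmx.
Proof.
move=> a0 c10 al0 dT fE.
have dM : is_diff u (momentum : 'rV[R]_2 -> R) momentum.
  exact: is_diff_linear momentum_linear momentum_continuous.
have d1 := is_diffB (is_diffZ a dM) (is_diff_cst c0 u).
have d2 := is_diffB (is_diffZ c1 dT) (is_diff_cst c2 u).
have [df dfE] := near_eq_is_diff fE (is_diff_vec2 d1 d2).
rewrite -row_free_unit; apply: inj_row_free => v.
rewrite mul_rV_lin1 /= dfE.
move=> E.
have {E} : vec2 (a * momentum v)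
    (c1 * (alpha * density v + beta * momentum v)) = vec2 0 0.
  move: E; rewrite /= !fctE /= !subr0 => ->.
  by apply/rowP => j; rewrite !mxE if_same.
move=> /vec2_inj[/eqP]; rewrite mulf_eq0 (negbTE a0) /= => /eqP m0.
rewrite m0 mulr0 addr0 => /eqP; rewrite !mulf_eq0 (negbTE c10) (negbTE al0) /= => /eqP rho0.
rewrite -[v]vec2_eta m0 rho0; apply/rowP => j; by rewrite !mxE if_same.
Qed.

End Coordinates.

(** * The junction conditions *)

Section Junction.
Context {R : realType} (p : R -> R).
Hypothesis hp : pressure_law p.
Local Notation dp := (derive1 p).
Local Notation root := (subsonic_root hp).
Local Notation J := (junction_arg R).

Lemma near_subsonic (u : 'rV[R]_2) : A0 p u -> \forall w \near u, A0 p w.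
Proof.
move=> /(A0P hp)[r0 sr].
have cd := @density_continuous R u; have cm := @momentum_continuous R u.
have N1 : \forall w \near u, 0 < density w.
  by apply: (@near_lt _ _ (fun=> 0) density) => //; exact: cst_continuous.
have N2 : \forall w \near u, momentum w ^+ 2 < density w ^+ 2 * dp (density w).
  apply: (@near_lt _ _ (fun w => momentum w ^+ 2)
    (fun w => density w ^+ 2 * dp (density w))) => //.
    exact: continuous_sqr.
  apply: (@continuousM _ _ (fun w => density w ^+ 2) (dp \o density));
    first exact: continuous_sqr.
  by apply: continuous_comp => //; exact: (dpressure_continuous hp).
by move: N1 N2; apply: filterS2 => w w1 w2; apply/(A0P hp).
Qed.

Lemma subsonic_args_open : open (subsonic_args p).
Proof.
rewrite openE => -[[al ul] [ar ur]] [/= al0 Al ar0 Ar]; rewrite /interior.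
have c11 := C1_at_continuous (C1_at_left_section ((al, ul), (ar, ur))).
have c21 := C1_at_continuous (C1_at_right_section ((al, ul), (ar, ur))).
have N1 : \forall x \near (((al, ul), (ar, ur)) : J), 0 < x.1.1.
  by apply: (@near_lt _ _ (fun=> 0) (fun x : J => x.1.1)) => //; exact: cst_continuous.
have N2 : \forall x \near (((al, ul), (ar, ur)) : J), 0 < x.2.1.
  by apply: (@near_lt _ _ (fun=> 0) (fun x : J => x.2.1)) => //; exact: cst_continuous.
have cl : {for (((al, ul), (ar, ur)) : J), continuous (fun x : J => x.1.2)}.
  apply: (@continuous_comp _ _ _ fst snd); [exact: cvg_fst|exact: cvg_snd].
have cr : {for (((al, ul), (ar, ur)) : J), continuous (fun x : J => x.2.2)}.
  apply: (@continuous_comp _ _ _ snd snd); exact: cvg_snd.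
have N3 : \forall x \near (((al, ul), (ar, ur)) : J), A0 p x.1.2
  by exact: cl (near_subsonic Al).
have N4 : \forall x \near (((al, ul), (ar, ur)) : J), A0 p x.2.2
  by exact: cr (near_subsonic Ar).
near=> x; split; by near: x.
Unshelve. all: by end_near. Qed.

Lemma flow_is_diff (u : 'rV[R]_2) : 0 < density u ->
  is_diff u (momentum_flow p) (fun v =>
    (dp (density u) - momentum u ^+ 2 / density u ^+ 2) * density v +
    (2 * momentum u / density u) * momentum v).
Proof.
move=> r0; have rn0 : density u != 0 by rewrite gt_eqF.
have dM := @is_diff_linear _ _ _ _ u (@momentum_linear R) (@momentum_continuous R).
have dD := @is_diff_linear _ _ _ _ u (@density_linear R) (@density_continuous R).
have dV := is_diff_comp_real (is_derive_inv rn0) dD.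
have dP := is_diff_comp_real (pressure_is_derive hp r0) dD.
apply: (is_diff_eq (is_diffD (is_diffM (is_diffM dM dM) dV) dP)).
by apply/funext => v; rewrite !fctE /GRing.scale /=; field.
Qed.

Lemma density_fun_C1 (V : normedModType R) (f : V -> R) x : 0 < f x ->
  C1_at f x -> C1_at (fun y => p (f y)) x.
Proof.
move=> f0; apply: (@C1_at_comp _ _ _ p dp).
  have : \forall z \near f x, 0 < z by apply: lt_nbhsr.
  by apply: filterS => z; exact: pressure_is_derive.
exact: dpressure_continuous.
Qed.

Lemma enthalpy_fun_C1 (V : normedModType R) (f : V -> R) x : 0 < f x ->
  C1_at f x -> C1_at (fun y => enthalpy hp (f y)) x.
Proof.
move=> f0; apply: (@C1_at_comp _ _ _ (enthalpy hp) (fun r => dp r / r)).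
  have : \forall z \near f x, 0 < z by apply: lt_nbhsr.
  by apply: filterS => z; exact: enthalpy_is_derive.
apply: (@continuousM _ _ dp GRing.inv); first exact: dpressure_continuous.
apply: continuousV; [by rewrite gt_eqF|exact: cvg_id].
Qed.

Lemma flow_C1 (V : normedModType R) (s r : V -> R) x : 0 < r x ->
  C1_at s x -> C1_at r x -> C1_at (fun y => flow p (s y) (r y)) x.
Proof.
move=> r0 Cs Cr; apply: C1_atD; last exact: density_fun_C1.
by apply: C1_atM; [exact: C1_atM|apply: C1_atV => //; rewrite gt_eqF].
Qed.

Lemma bernoulli_C1 (V : normedModType R) (s r : V -> R) x : 0 < r x ->
  C1_at s x -> C1_at r x -> C1_at (fun y => bernoulli hp (s y) (r y)) x.
Proof.
move=> r0 Cs Cr; apply: C1_atD; last exact: enthalpy_fun_C1.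
apply: C1_atM; first exact: C1_atM.
apply: C1_atV; first by rewrite mulf_neq0 ?sqrf_eq0// gt_eqF.
by apply: C1_atM; [exact: C1_at_cst|exact: C1_atM].
Qed.

(* [I] is [a P(u)] for (L), [p] for (p), [P] for (P) and the Bernoulli quantity for (S). *)
Definition conserves (Phi : junction_function R) (I : R -> 'rV[R]_2 -> R) :=
  forall (al ar : R) (ul ur : 'rV[R]_2), 0 < al -> 0 < ar -> A0 p ul -> A0 p ur ->
    (vanishes Phi al ul ar ur <->
     ar * momentum ur = al * momentum ul /\ I ar ur = I al ul).

Lemma vec2_eq0 (x y : R) : vec2 x y = 0 <-> x = 0 /\ y = 0.
Proof.
have E : vec2 0 0 = 0 :> 'rV[R]_2 by apply/rowP => j; rewrite !mxE if_same.
by split=> [|[-> ->]//]; rewrite -E => /vec2_inj.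
Qed.

Lemma A0_opp (rho q : R) : A0 p (vec2 rho q) -> A0 p (vec2 rho (- q)).
Proof.
move=> /(A0P hp); rewrite density_vec2 momentum_vec2 => /subsonicN H.
by apply/(A0P hp); rewrite density_vec2 momentum_vec2.
Qed.

Lemma A0_rest (rho : R) : 0 < rho -> A0 p (vec2 rho 0).
Proof.
move=> r0; apply/(A0P hp); rewrite density_vec2 momentum_vec2; split=> //.
by rewrite expr0n mulr_gt0 ?exprn_gt0// (dpressure_gt0 hp).
Qed.

(** Agreement of discharge and [I] is an equivalence relation. Transitivity gives consistency,
    evenness in the momentum gives symmetry; at equal sections the momenta agree and injectivity in
    the density identifies the states. *)
Lemma conserves_properties (Phi : junction_function R) (I : R -> 'rV[R]_2 -> R) :
  conserves Phi I ->
  (forall a rho q, I a (vec2 rho (- q)) = I a (vec2 rho q)) ->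
  (forall a rho rho' q, 0 < a -> A0 p (vec2 rho q) -> A0 p (vec2 rho' q) ->
     I a (vec2 rho q) = I a (vec2 rho' q) -> rho = rho') ->
  [/\ Phi_no_junction p Phi, Phi_symmetric p Phi & Phi_consistent p Phi].
Proof.
move=> PhiI Iopp Iinj; split.
- move=> a ul ur a0 Al Ar; rewrite PhiI//; split=> [[/(mulfI (lt0r_neq0 a0)) qE]|->//].
  rewrite -[ur]vec2_eta -[ul]vec2_eta in Al Ar *; rewrite qE in Ar *.
  by move=> /(Iinj _ _ _ _ a0 Ar Al) ->.
- move=> al ar rhol ql rhor qr al0 ar0 Al Ar.
  rewrite PhiI// PhiI//; [|exact: A0_opp|exact: A0_opp].
  rewrite !momentum_vec2 !Iopp !mulrN; split=> -[E ->]; first by rewrite E.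
  by split=> //; apply: oppr_inj.
- move=> al am ar ul um ur al0 am0 ar0 Al Am Ar.
  by rewrite !PhiI// => -[-> ->] [-> ->].
Qed.

Lemma conserves_hydrostatic (Phi : junction_function R) (I : R -> 'rV[R]_2 -> R) :
  conserves Phi I ->
  (forall al ar rho rho', 0 < al -> 0 < ar -> 0 < rho -> 0 < rho' ->
     (I ar (vec2 rho' 0) = I al (vec2 rho 0)) <-> p rho = p rho') ->
  Phi_hydrostatic p Phi.
Proof.
move=> PhiI H al ar rho rho' al0 ar0 r0 r'0.
rewrite PhiI//; [|exact: A0_rest|exact: A0_rest].
by rewrite !momentum_vec2 !mulr0 H//; split=> // -[].
Qed.

Lemma vanishes_vec2 (D : set J) (f g : J -> R) al ul ar ur :
  D ((al, ul), (ar, ur)) ->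
  vanishes (JunctionFunction D (fun x => vec2 (f x) (g x))) al ul ar ur <->
  f ((al, ul), (ar, ur)) = 0 /\ g ((al, ul), (ar, ur)) = 0.
Proof.
by move=> Dx; split=> [[_ /vec2_eq0//]|/vec2_eq0 H]; split.
Qed.

Lemma subr_eq0P (x y : R) : x - y = 0 <-> x = y.
Proof. by split=> [/subr0_eq//|->]; rewrite subrr. Qed.

Lemma Phi_L_conserves : conserves (Phi_L p) (fun a u => a * momentum_flow p u).
Proof.
move=> al ar ul ur al0 ar0 Al Ar; rewrite /Phi_L vanishes_vec2; last by split.
by rewrite !subr_eq0P.
Qed.

Lemma Phi_p_conserves : conserves (Phi_p p) (fun=> fun u => p (density u)).
Proof.
move=> al ar ul ur al0 ar0 Al Ar; rewrite /Phi_p vanishes_vec2; last by split.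
by rewrite !subr_eq0P.
Qed.

Lemma Phi_P_conserves : conserves (Phi_P p) (fun=> momentum_flow p).
Proof.
move=> al ar ul ur al0 ar0 Al Ar; rewrite /Phi_P vanishes_vec2; last by split.
by rewrite !subr_eq0P.
Qed.

(** * Condition (S) in terms of the Bernoulli quantity *)

Definition state_bernoulli (u : 'rV[R]_2) : R := bernoulli hp (momentum u) (density u).

(** This is [Q(a_r)], the momentum that the Cauchy problem reaches at the right section. *)
Definition transported_speed (x : J) : R := x.1.1 * momentum x.1.2 / x.2.1.

(** Existence for the differential equation is traded for solvability of a scalar equation, whose
    openness is known. *)
Lemma domain_Phi_S : domain (Phi_S p) = subsonic_args p `&`
  [set x | solvable hp (transported_speed x) (state_bernoulli x.1.2)].
Proof.
apply/seteqP; split=> x [[a1 A1 a2 A2] H]; split=> //.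
  have [r [q S]] := H; exists (r x.2.1); exact: stationary_solvable A1 S.
exact: (stationary_exists (hp := hp)).
Qed.

(** The boundary term of the integral at the left section cancels the left momentum flow. *)
Lemma value_Phi_S x : domain (Phi_S p) x ->
  value (Phi_S p) x = vec2 (mass_defect x) (x.2.1 * momentum_flow p x.2.2 -
    x.2.1 * flow p (transported_speed x)
      (root (transported_speed x) (state_bernoulli x.1.2))).
Proof.
move=> [[a1 A1 a2 A2] H]; rewrite /= (integral_stationary_density hp A1 H).
congr vec2; rewrite -/(transported_speed x) -/(state_bernoulli _); lra.
Qed.

Lemma Phi_S_conserves : conserves (Phi_S p) (fun=> state_bernoulli).
Proof.
move=> al ar ul ur al0 ar0 Al Ar.
have ar_n0 := lt0r_neq0 ar0.
have sr : subsonic p (momentum ur) (density ur) by exact/(A0P hp).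
rewrite /vanishes; split.
  move=> [D]; rewrite (value_Phi_S D) => /vec2_eq0[/subr0_eq /= qE /subr0_eq /= PE].
  have tE : transported_speed ((al, ul), (ar, ur)) = momentum ur.
    by rewrite /transported_speed /= -qE; field.
  split=> //; move: D; rewrite domain_Phi_S => -[_ /=].
  move: PE; rewrite tE => /(mulfI ar_n0) PE /subsonic_rootP [sR <-].
  by rewrite /state_bernoulli (flow_inj hp sr sR PE).
move=> [qE bE].
have tE : transported_speed ((al, ul), (ar, ur)) = momentum ur.
  by rewrite /transported_speed /= -qE; field.
have rE : root_of hp (momentum ur) (state_bernoulli ul) (density ur) by split.
(* The domain condition comes for free here: [density ur] is itself a root. *)
have D : domain (Phi_S p) ((al, ul), (ar, ur)).
  rewrite domain_Phi_S; split; first by split.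
  by rewrite /= tE; exists (density ur).
split=> //; rewrite (value_Phi_S D) tE (subsonic_rootE rE).
by apply/vec2_eq0; rewrite /mass_defect /= qE !subrr.
Qed.

(** * Regularity of the four conditions *)

Lemma transported_speed_C1 (x : J) : x.2.1 != 0 -> C1_at transported_speed x.
Proof.
move=> a0; apply: C1_atM; last by apply: C1_atV => //; exact: C1_at_right_section.
apply: C1_atM; first exact: C1_at_left_section.
exact: C1_at_left_state (@momentum_linear R) (@momentum_continuous R).
Qed.

Lemma mass_defect_C1 (x : J) : C1_at (@mass_defect R) x.
Proof.
apply: C1_atB; apply: C1_atM.
- exact: C1_at_right_section.
- exact: C1_at_right_state (@momentum_linear R) (@momentum_continuous R).
- exact: C1_at_left_section.
- exact: C1_at_left_state (@momentum_linear R) (@momentum_continuous R).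
Qed.

Lemma left_flow_C1 (x : J) : 0 < density x.1.2 ->
  C1_at (fun y : J => momentum_flow p y.1.2) x.
Proof.
move=> r0; apply: (@flow_C1 _ (fun y : J => momentum y.1.2)
  (fun y : J => density y.1.2)) => //.
- exact: C1_at_left_state (@momentum_linear R) (@momentum_continuous R).
- exact: C1_at_left_state (@density_linear R) (@density_continuous R).
Qed.

Lemma right_flow_C1 (x : J) : 0 < density x.2.2 ->
  C1_at (fun y : J => momentum_flow p y.2.2) x.
Proof.
move=> r0; apply: (@flow_C1 _ (fun y : J => momentum y.2.2)
  (fun y : J => density y.2.2)) => //.
- exact: C1_at_right_state (@momentum_linear R) (@momentum_continuous R).
- exact: C1_at_right_state (@density_linear R) (@density_continuous R).
Qed.

Lemma state_bernoulli_C1 (x : J) : 0 < density x.1.2 ->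
  C1_at (fun y : J => state_bernoulli y.1.2) x.
Proof.
move=> r0; apply: (@bernoulli_C1 _ (fun y : J => momentum y.1.2)
  (fun y : J => density y.1.2)) => //.
- exact: C1_at_left_state (@momentum_linear R) (@momentum_continuous R).
- exact: C1_at_left_state (@density_linear R) (@density_continuous R).
Qed.

Lemma near_right_state (D : set J) al ul ar ur : open D -> D ((al, ul), (ar, ur)) ->
  \forall w \near ur, D ((al, ul), (ar, w)).
Proof.
move=> oD Dx.
have cw : {for ur, continuous (fun w => ((al, ul), (ar, w)) : J)}.
  apply: differentiable_continuous; apply: (@differentiable_pair _ _ _ _ (fun=> (al, ul))).
    exact: differentiable_cst.
  apply: (@differentiable_pair _ _ _ _ (fun=> ar) id); first exact: differentiable_cst.
  exact: ex_diff.
exact: cw (open_nbhs_nbhs (conj oD Dx)).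
Qed.

Lemma A0_dflow_neq0 (u : 'rV[R]_2) : A0 p u ->
  dp (density u) - momentum u ^+ 2 / density u ^+ 2 != 0.
Proof. by move=> /(A0P hp) /subsonic_dflow_gt0 /lt0r_neq0. Qed.

Lemma Phi_L_regular : Phi_regular p (Phi_L p).
Proof.
split.
  apply: C1_at_C1_on; first exact: subsonic_args_open.
  move=> x [_ [rl _ _] _ [rr _ _]]; apply: C1_at_vec2; first exact: mass_defect_C1.
  apply: C1_atB; apply: C1_atM.
  - exact: C1_at_right_section.
  - exact: right_flow_C1.
  - exact: C1_at_left_section.
  - exact: left_flow_C1.
move=> al ar ul ur al0 ar0 _ /interior_subset Ar _.
have [r0 _ _] := Ar.
apply: (@jacobian_unit _ _ (momentum_flow p) ur (al * momentum ul) ar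
  (al * momentum_flow p ul) ar _ _ (lt0r_neq0 ar0) _ (A0_dflow_neq0 Ar) (flow_is_diff r0));
  first exact: lt0r_neq0.
by apply: (@nearW _ (nbhs ur)) => w.
Qed.

Lemma Phi_P_regular : Phi_regular p (Phi_P p).
Proof.
split.
  apply: C1_at_C1_on; first exact: subsonic_args_open.
  move=> x [_ [rl _ _] _ [rr _ _]]; apply: C1_at_vec2; first exact: mass_defect_C1.
  by apply: C1_atB; [exact: right_flow_C1|exact: left_flow_C1].
move=> al ar ul ur al0 ar0 _ /interior_subset Ar _.
have [r0 _ _] := Ar.
apply: (@jacobian_unit _ _ (momentum_flow p) ur (al * momentum ul) 1
  (momentum_flow p ul) ar _ _ (lt0r_neq0 ar0) _ (A0_dflow_neq0 Ar) (flow_is_diff r0));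
  first exact: oner_neq0.
by apply: (@nearW _ (nbhs ur)) => w; rewrite mul1r.
Qed.

Lemma Phi_p_regular : Phi_regular p (Phi_p p).
Proof.
split.
  apply: C1_at_C1_on; first exact: subsonic_args_open.
  move=> x [_ [rl _ _] _ [rr _ _]]; apply: C1_at_vec2; first exact: mass_defect_C1.
  apply: C1_atB.
    apply: (density_fun_C1 (f := fun x : J => density x.2.2)) => //.
    exact: C1_at_right_state (@density_linear R) (@density_continuous R).
  apply: (density_fun_C1 (f := fun x : J => density x.1.2)) => //.
  exact: C1_at_left_state (@density_linear R) (@density_continuous R).
move=> al ar ul ur al0 ar0 _ /interior_subset [r0 _ _] _.
have dD := @is_diff_linear _ _ _ _ ur (@density_linear R) (@density_continuous R).
have dT : is_diff ur (fun u => p (density u))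
    (fun v => dp (density ur) * density v + 0 * momentum v).
  apply: (is_diff_eq (is_diff_comp_real (pressure_is_derive hp r0) dD)).
  by apply/funext => v; rewrite mul0r addr0.
apply: (@jacobian_unit _ _ _ ur (al * momentum ul) 1 (p (density ul)) ar _ _ _ _ _ dT);
  rewrite ?lt0r_neq0// ?(dpressure_gt0 hp)//.
by apply: (@nearW _ (nbhs ur)) => w; rewrite mul1r.
Qed.

Lemma domain_Phi_S_open : open (domain (Phi_S p)).
Proof.
rewrite domain_Phi_S openE => x [/= Sx solx].
have [a1 [rl _ _] a2 _] := Sx.
have N1 : \forall y \near x, subsonic_args p y.
  exact: open_nbhs_nbhs (conj subsonic_args_open Sx).
have N2 := near_solvable (C1_at_continuous (transported_speed_C1 (lt0r_neq0 a2)))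
  (C1_at_continuous (state_bernoulli_C1 rl)) solx.
by rewrite /interior; move: N1 N2; apply: filterS2 => y.
Qed.

Lemma Phi_S_regular : Phi_regular p (Phi_S p).
Proof.
split.
  apply: C1_at_C1_on; first exact: domain_Phi_S_open.
  move=> x Dx.
  have N : \forall y \near x, domain (Phi_S p) y.
    exact: open_nbhs_nbhs (conj domain_Phi_S_open Dx).
  move: (Dx); rewrite domain_Phi_S => -[[_ [rl _ _] a2 [rr _ _]] solx].
  have Ct := transported_speed_C1 (lt0r_neq0 a2).
  have Cb := state_bernoulli_C1 rl.
  have [[R0 _] _] := subsonic_rootP solx.
  have Cr := @subsonic_root_C1 _ _ hp _ transported_speed
    (fun y => state_bernoulli y.1.2) x Ct Cb solx.
  have := C1_at_vec2 (mass_defect_C1 x) (C1_atB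
    (C1_atM (C1_at_right_section x) (right_flow_C1 rr))
    (C1_atM (C1_at_right_section x)
      (@flow_C1 _ transported_speed
        (fun y => root (transported_speed y) (state_bernoulli y.1.2)) x R0 Ct Cr))).
  by apply: C1_at_near; apply: filterS N => y /value_Phi_S ->.
move=> al ar ul ur al0 ar0 _ /interior_subset Ar Dx.
have [r0 _ _] := Ar.
have N := near_right_state domain_Phi_S_open Dx.
(* With the left state and both sections fixed, the root does not vary with [ur]: only
   [momentum_flow p] is differentiated. *)
pose s := al * momentum ul / ar.
apply: (@jacobian_unit _ _ (momentum_flow p) ur (al * momentum ul) ar
  (ar * flow p s (root s (state_bernoulli ul))) ar
  _ _ (lt0r_neq0 ar0) _ (A0_dflow_neq0 Ar) (flow_is_diff r0));
  first exact: lt0r_neq0.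
by apply: filterS N => w /value_Phi_S ->.
Qed.

Lemma flow_opp (rho q : R) :
  momentum_flow p (vec2 rho (- q)) = momentum_flow p (vec2 rho q).
Proof. by rewrite !momentum_flowE /flow !density_vec2 !momentum_vec2 sqrrN. Qed.

Lemma state_flow_inj (rho rho' q : R) : A0 p (vec2 rho q) -> A0 p (vec2 rho' q) ->
  momentum_flow p (vec2 rho q) = momentum_flow p (vec2 rho' q) -> rho = rho'.
Proof.
move=> /(A0P hp) + /(A0P hp); rewrite !momentum_flowE !density_vec2 !momentum_vec2.
exact: flow_inj.
Qed.

Lemma flow_rest (rho : R) : momentum_flow p (vec2 rho 0) = p rho.
Proof. by rewrite momentum_flowE density_vec2 momentum_vec2 /flow expr0n mul0r add0r. Qed.

End Junction.

Theorem proposition2p3 (R : realType) (p : R -> R) (hp : pressure_law p) :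
  (forall Phi : junction_function R,
     (Phi = Phi_L p \/ Phi = Phi_p p \/ Phi = Phi_P p \/ Phi = Phi_S p) ->
     [/\ Phi_regular p Phi, Phi_no_junction p Phi,
         Phi_symmetric p Phi & Phi_consistent p Phi]) /\
  [/\ Phi_hydrostatic p (Phi_p p), Phi_hydrostatic p (Phi_P p)
    & Phi_hydrostatic p (Phi_S p)] /\
  ~ Phi_hydrostatic p (Phi_L p).
Proof.
split; [|split; [split|]].
- move=> Phi [->|[->|[->|->]]].
  + have [] := conserves_properties hp (Phi_L_conserves (p := p)).
    * by move=> a rho q; rewrite flow_opp.
    * by move=> a rho rho' q a0 A A' /(mulfI (lt0r_neq0 a0)); exact: state_flow_inj.
    by split=> //; exact: Phi_L_regular.
  + have [] := conserves_properties hp (Phi_p_conserves (p := p)).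
    * by move=> a rho q; rewrite !density_vec2.
    * move=> a rho rho' q _ [+ _ _] [+ _ _]; rewrite !density_vec2.
      exact: (pressure_inj hp).
    by split=> //; exact: Phi_p_regular.
  + have [] := conserves_properties hp (Phi_P_conserves (p := p)).
    * by move=> a rho q; rewrite flow_opp.
    * by move=> a rho rho' q _; exact: state_flow_inj.
    by split=> //; exact: Phi_P_regular.
  + have [] := conserves_properties hp (Phi_S_conserves hp).
    * move=> a rho q; rewrite /state_bernoulli /bernoulli.
      by rewrite !density_vec2 !momentum_vec2 sqrrN.
    * move=> a rho rho' q _ /(A0P hp) + /(A0P hp).
      rewrite /state_bernoulli !density_vec2 !momentum_vec2; exact: bernoulli_inj.
    by split=> //; exact: Phi_S_regular.
- apply: (conserves_hydrostatic hp (Phi_p_conserves (p := p))) => al ar rho rho' _ _ _ _.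
  by rewrite !density_vec2; split=> ->.
- apply: (conserves_hydrostatic hp (Phi_P_conserves (p := p))) => al ar rho rho' _ _ _ _.
  by rewrite !flow_rest; split=> ->.
(* At rest, equal Bernoulli quantities and equal pressures both amount to equal densities. *)
- apply: (conserves_hydrostatic hp (Phi_S_conserves hp)) => al ar rho rho' _ _ r0 r'0.
  have /(A0P hp) := A0_rest hp r0; have /(A0P hp) := A0_rest hp r'0.
  rewrite /state_bernoulli !density_vec2 !momentum_vec2 => s' s; split.
    by move=> /(bernoulli_inj s' s) ->.
  by move=> /(pressure_inj hp r0 r'0) ->.
- move=> H; have [_ /(_ erefl)] := H 1 2 1 1 ltr01 (ltr0Sn R 1) ltr01 ltr01.
  rewrite Phi_L_conserves//; [|exact: A0_rest|exact: A0_rest].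
  rewrite flow_rest => -[_ E].
  have h0 : 0 < 2^-1 :> R by rewrite invr_gt0.
  have h1 : 2^-1 < 1 :> R by rewrite invf_lt1// ltr1n.
  have := pressure_lt hp h0 h1; case: hp => _ /(_ _ (ltW h0)) + _ _; lra.
Qed.
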